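(* Let $q$ be a power of a prime, $A=\mathbb{F}_q[t]$, $K$ a finite field extension of $\mathbb{F}_q(t)$, and $\phi:A\to K\{\tau\}$ a Drinfeld module. Assume the following hypothesis on $\phi$ and $K$: (H1) for every finite place $v\in M_K$ and all $\gamma,\alpha\in K$, there exist positive constants $C_1,C_2,C_3$ (depending only on $v,\phi,\gamma,\alpha$) such that for each $P\in\mathbb{F}_q[t]$, either $\phi_P(\gamma)=\alpha$ or $$\log\left|\phi_P(\gamma)-\alpha\right|_v\ge -C_1-C_2(\deg P)^{C_3},$$ with the convention $\deg 0=0$ in this inequality. Let $\beta\in K$ be a nontorsion point for $\phi$, let $\alpha\in K$ be an arbitrary point, and let $S$ be a finite set of places in $M_K$. Then there are only finitely many $Q\in A$ such that $\phi_Q(\beta)$ is $S$-integral with respect to $\alpha$.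
   Context: Let $\tau$ be the Frobenius $x\mapsto x^q$, and let $K\{\tau\}$ be the ring of polynomials in $\tau$ with coefficients in $K$, with usual addition and with multiplication given by composition of functions. A Drinfeld module is a ring homomorphism $\phi:A\to K\{\tau\}$, $a\mapsto\phi_a$, such that for every $a\in A$ the coefficient of $\tau^0$ in $\phi_a$ is $a$, and there is $a\in A$ with $\phi_a\neq a\tau^0$. A point $x\in\overline{K}$ is torsion for $\phi$ if $\phi_Q(x)=0$ for some nonzero $Q\in A$, and nontorsion otherwise. $M_K$ is the set of places of $K$; for each $v\in M_K$ the absolute value $|\cdot|_v$ is non-archimedean, normalized so that $\log|x|_v\in\mathbb{Z}$ for all nonzero $x\in K$ and so that the product formula $\prod_{v\in M_K}|x|_v=1$ holds for all nonzero $x\in K$. Let $v_\infty$ be the place of $\mathbb{F}_q(t)$ with $v_\infty(f/g)=\deg g-\deg f$ for nonzero $f,g\in\mathbb{F}_q[t]$. A place in $M_K$ is called infinite if it lies over $v_\infty$, and finite otherwise. For a finite set $S\subset M_K$ and $\alpha,\beta\in K$, $\beta$ is $S$-integral with respect to $\alpha$ if for every $v\in M_K\setminus S$: if $|\alpha|_v\le 1$ then $|\alpha-\beta|_v\ge 1$; and if $|\alpha|_v>1$ then $|\beta|_v\le 1$. (For points of $\overline{K}$ the same conditions are required for all $K$-conjugates of $\alpha$ and $\beta$.) *)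

(* Defs.v *)
From HB Require Import structures.
From mathcomp Require Import all_boot all_order all_algebra all_field.
From mathcomp Require Import all_classical all_reals all_analysis.
From mathcomp Require Import zify.

Set Implicit Arguments.
Unset Strict Implicit.
Unset Printing Implicit Defensive.

Import Order.TTheory GRing.Theory Num.Theory.
Local Open Scope classical_set_scope.
Local Open Scope ring_scope.

(* Twisted (Ore) polynomials: [p : skew_poly s] stands for the operator
   \sum_i p`_i tau^i with tau acting as [s].  The additive structure is that of
   {poly R}; multiplication is determined by tau * a = s a * tau, so that it is
   composition of operators (lemma [skew_evalM]).  [skew_poly s] is only an
   alias of {poly R}: the product must be taken at type [skew_poly s]. *)
Definition skew_poly (R : nzRingType) (s : {rmorphism R -> R}) : Type :=
  {poly R}.

HB.instance Definition _ (R : nzRingType) (s : {rmorphism R -> R}) :=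
  GRing.Zmodule.copy (skew_poly s) {poly R}.

Section SkewPoly.
Variables (R : nzRingType) (s : {rmorphism R -> R}).
Implicit Types (p q r : {poly R}).

Definition skew_mul p q : {poly R} :=
  \sum_(i < size p) p`_i *: (map_poly (iter i s) q * 'X^i).

Lemma iter_s0 i : iter i s 0 = 0.
Proof. by elim: i => //= i ->; rewrite rmorph0. Qed.

Lemma iter_s1 i : iter i s 1 = 1.
Proof. by elim: i => //= i ->; rewrite rmorph1. Qed.

Lemma iter_sD i : {morph iter i s : x y / x + y}.
Proof. by move=> x y; elim: i => //= i ->; rewrite rmorphD. Qed.

Lemma iter_sM i : {morph iter i s : x y / x * y}.
Proof. by move=> x y; elim: i => //= i ->; rewrite rmorphM. Qed.

Lemma iter_s_sum i (I : Type) (l : seq I) (P : pred I) (G : I -> R) :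
  iter i s (\sum_(j <- l | P j) G j) = \sum_(j <- l | P j) iter i s (G j).
Proof. exact: (big_morph _ (iter_sD i) (iter_s0 i)). Qed.

Lemma map_iterD i p q :
  map_poly (iter i s) (p + q) = map_poly (iter i s) p + map_poly (iter i s) q.
Proof.
by apply/polyP=> k; rewrite coefD !coef_map_id0 ?iter_s0// coefD iter_sD.
Qed.

Lemma map_iter0 i : map_poly (iter i s) 0 = 0.
Proof. by apply/polyP=> k; rewrite coef_map_id0 ?iter_s0// coef0 iter_s0. Qed.

Lemma map_iter_monom i c k :
  map_poly (iter i s) (c *: 'X^k) = iter i s c *: 'X^k.
Proof.
apply/polyP=> l; rewrite coef_map_id0 ?iter_s0// !coefZ !coefXn.
by case: eqP => _; rewrite ?mulr1 ?mulr0 ?iter_s0.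
Qed.

Lemma skew_mul_wide n p q : (size p <= n)%N ->
  skew_mul p q = \sum_(i < n) p`_i *: (map_poly (iter i s) q * 'X^i).
Proof.
move=> le_pn; rewrite /skew_mul (big_ord_widen n
  (fun i => p`_i *: (map_poly (iter i s) q * 'X^i)) le_pn) big_mkcond /=.
by apply: eq_bigr => i _; case: ltnP => // /(nth_default 0) ->; rewrite scale0r.
Qed.

Lemma skew_mulDl : left_distributive skew_mul +%R.
Proof.
move=> p q r; pose n := maxn (size p) (size q).
rewrite (@skew_mul_wide n) ?size_polyD// (@skew_mul_wide n p) ?leq_maxl//.
rewrite (@skew_mul_wide n q) ?leq_maxr// -big_split.
by apply: eq_bigr => i _; rewrite coefD scalerDl.
Qed.

Lemma skew_mulDr : right_distributive skew_mul +%R.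
Proof.
move=> p q r; rewrite /skew_mul -big_split; apply: eq_bigr => i _.
by rewrite map_iterD mulrDl scalerDr.
Qed.

Lemma skew_mul0p q : skew_mul 0 q = 0.
Proof. by rewrite /skew_mul size_poly0 big_ord0. Qed.

Lemma skew_mulp0 p : skew_mul p 0 = 0.
Proof.
by rewrite /skew_mul big1// => i _; rewrite map_iter0 mul0r scaler0.
Qed.

Lemma skew_mul_monoml c i q :
  skew_mul (c *: 'X^i) q = c *: (map_poly (iter i s) q * 'X^i).
Proof.
rewrite (@skew_mul_wide i.+1); last first.
  by rewrite (leq_trans (size_scale_leq _ _))// size_polyXn.
rewrite big_ord_recr /= big1 ?add0r => [|j _].
  by rewrite coefZ coefXn eqxx mulr1.
by rewrite coefZ coefXn ltn_eqF// mulr0 scale0r.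
Qed.

Lemma skew_mul_monom c d i j :
  skew_mul (c *: 'X^i) (d *: 'X^j) = (c * iter i s d) *: 'X^(i + j).
Proof.
by rewrite skew_mul_monoml map_iter_monom -scalerAl -exprD addnC scalerA.
Qed.

Lemma monom_ind (P : {poly R} -> Prop) : P 0 ->
  (forall p q, P p -> P q -> P (p + q)) -> (forall c i, P (c *: 'X^i)) ->
  forall p, P p.
Proof.
by move=> P0 PD Pm p; rewrite -(coefK p) poly_def; apply: big_ind.
Qed.

Lemma skew_mulA : associative skew_mul.
Proof.
move=> p q r; elim/monom_ind: p => [|p p' Hp Hp'|c i].
- by rewrite !skew_mul0p.
- by rewrite !skew_mulDl Hp Hp'.
elim/monom_ind: q => [|q q' Hq Hq'|d j].
- by rewrite skew_mul0p skew_mulp0 skew_mul0p.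
- by rewrite skew_mulDl !skew_mulDr skew_mulDl Hq Hq'.
elim/monom_ind: r => [|r r' Hr Hr'|e k].
- by rewrite !skew_mulp0.
- by rewrite !skew_mulDr Hr Hr'.
by rewrite !skew_mul_monom iter_sM mulrA addnA iterD.
Qed.

Lemma skew_mul1p : left_id 1 skew_mul.
Proof.
move=> q; rewrite -[1](scale1r ('X^0 : {poly R})) skew_mul_monoml /=.
by rewrite map_poly_id// expr0 mulr1 scale1r.
Qed.

Lemma skew_mulp1 : right_id 1 skew_mul.
Proof.
move=> p; elim/monom_ind: p => [|p q Hp Hq|c i]; first exact: skew_mul0p.
- by rewrite skew_mulDl Hp Hq.
rewrite -[1 in LHS](scale1r ('X^0 : {poly R})) skew_mul_monom iter_s1 mulr1.
by rewrite addn0.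
Qed.

HB.instance Definition _ := GRing.Zmodule_isNzRing.Build (skew_poly s)
  skew_mulA skew_mul1p skew_mulp1 skew_mulDl skew_mulDr
  (@oner_neq0 {poly R}).

Definition skew_eval (p : skew_poly s) (x : R) : R :=
  \sum_(i < size (p : {poly R})) (p : {poly R})`_i * iter i s x.

Lemma skew_eval_wide n (p : skew_poly s) x : (size (p : {poly R}) <= n)%N ->
  skew_eval p x = \sum_(i < n) (p : {poly R})`_i * iter i s x.
Proof.
move=> le_pn; rewrite /skew_eval (big_ord_widen n
  (fun i => (p : {poly R})`_i * iter i s x) le_pn) big_mkcond /=.
by apply: eq_bigr => i _; case: ltnP => // /(nth_default 0) ->; rewrite mul0r.
Qed.

Lemma skew_eval0 x : skew_eval 0 x = 0.
Proof. by rewrite /skew_eval size_poly0 big_ord0. Qed.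

Lemma skew_evalDr (p : skew_poly s) x y :
  skew_eval p (x + y) = skew_eval p x + skew_eval p y.
Proof.
by rewrite -big_split; apply: eq_bigr => i _; rewrite iter_sD mulrDr.
Qed.

Lemma skew_eval0r (p : skew_poly s) : skew_eval p 0 = 0.
Proof. by apply: big1 => i _; rewrite iter_s0 mulr0. Qed.

Lemma skew_evalD (p q : skew_poly s) x :
  skew_eval (p + q) x = skew_eval p x + skew_eval q x.
Proof.
pose n := maxn (size (p : {poly R})) (size (q : {poly R})).
rewrite (@skew_eval_wide n (p + q)); last exact: size_polyD.
rewrite (@skew_eval_wide n p) ?leq_maxl// (@skew_eval_wide n q) ?leq_maxr//.
by rewrite -big_split; apply: eq_bigr => i _; rewrite coefD mulrDl.
Qed.

Lemma skew_eval_monom c i x :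
  skew_eval (c *: 'X^i : {poly R}) x = c * iter i s x.
Proof.
rewrite (@skew_eval_wide i.+1); last first.
  by rewrite (leq_trans (size_scale_leq _ _))// size_polyXn.
rewrite big_ord_recr /= big1 ?add0r => [|j _].
  by rewrite coefZ coefXn eqxx mulr1.
by rewrite coefZ coefXn ltn_eqF// mulr0 mul0r.
Qed.

Lemma skew_evalM (p q : skew_poly s) x :
  skew_eval (p * q) x = skew_eval p (skew_eval q x).
Proof.
rewrite -[p * q]/(skew_mul p q).
elim/monom_ind: p => [|p p' Hp Hp'|c i].
- by rewrite skew_mul0p !skew_eval0.
- by rewrite skew_mulDl !skew_evalD Hp Hp'.
elim/monom_ind: q => [|q q' Hq Hq'|d j].
- by rewrite skew_mulp0 !skew_eval0 skew_eval0r.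
- by rewrite skew_mulDr !skew_evalD skew_evalDr Hq Hq'.
by rewrite skew_mul_monom !skew_eval_monom iter_sM iterD mulrA.
Qed.

End SkewPoly.

(* F is the field with q = #|F| elements, A = F[t] is {poly F}, and K is a
   finite extension of F(t) = {fraction {poly F}}. *)
Definition embA (F : finFieldType) (K : fieldExtType {fraction {poly F}})
  (a : {poly F}) : K := (FracField.tofrac a)%:A.

Definition frob (F : finFieldType) (K : fieldExtType {fraction {poly F}})
  (x : K) : K := x ^+ #|F|.

Section Frobenius.
Variables (F : finFieldType) (K : fieldExtType {fraction {poly F}}).

Lemma pchar_nat_card : (GRing.pchar K).-nat #|F|.
Proof.
have [p p_pr pF] := finPcharP F.
have pK : p \in GRing.pchar K.
  rewrite pchar_lalg; have := rmorph_pchar (@FracField.tofrac {poly F}).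
  by apply; apply: (rmorph_pchar (@polyC F)).
rewrite (card_pprimeChar pF) pnatX; apply/orP; left.
by rewrite pnatE.
Qed.

Lemma frob_is_zmod_morphism : zmod_morphism (@frob F K).
Proof.
move=> x y; apply/eqP; rewrite eq_sym subr_eq /frob -exprDn_pchar ?subrK//.
exact: pchar_nat_card.
Qed.

Lemma frob_is_monoid_morphism : monoid_morphism (@frob F K).
Proof. by split=> [|x y]; rewrite /frob ?expr1n ?exprMn. Qed.

HB.instance Definition _ :=
  GRing.isZmodMorphism.Build K K (@frob F K) frob_is_zmod_morphism.
HB.instance Definition _ :=
  GRing.isMonoidMorphism.Build K K (@frob F K) frob_is_monoid_morphism.

End Frobenius.

Definition Ktau (F : finFieldType) (K : fieldExtType {fraction {poly F}}) :
  nzRingType := skew_poly (@frob F K).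

Definition is_drinfeld_module (F : finFieldType)
    (K : fieldExtType {fraction {poly F}})
    (phi : {rmorphism {poly F} -> Ktau K}) : Prop :=
  (forall a, (phi a : {poly K})`_0 = embA K a) /\
  (exists a, (phi a : {poly K}) <> (embA K a)%:P).

Definition torsion (F : finFieldType) (K : fieldExtType {fraction {poly F}})
    (phi : {rmorphism {poly F} -> Ktau K}) (x : K) : Prop :=
  exists Q : {poly F}, Q != 0 /\ skew_eval (phi Q) x = 0.

Definition polydeg (F : fieldType) (P : {poly F}) : nat := (size P).-1.

Definition is_absval (R : realType) (L : fieldType) (f : L -> R) : Prop :=
  [/\ forall x, 0 <= f x,
      forall x, f x = 0 <-> x = 0,
      forall x y, f (x * y) = f x * f y &
      forall x y, f (x + y) <= f x + f y].

Definition nonarchimedean (R : realType) (L : fieldType) (f : L -> R) : Prop :=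
  forall x y, f (x + y) <= Num.max (f x) (f y).

Definition nontrivial_absval (R : realType) (L : fieldType) (f : L -> R) :
  Prop := exists x, x != 0 /\ f x != 1.

Definition absval_equiv (R : realType) (L : Type) (f g : L -> R) : Prop :=
  exists s : R, 0 < s /\ forall x, g x = f x `^ s.

(* A place is an equivalence class of nontrivial absolute values.  The set M_K
   is represented by a set MK of normalized absolute values containing exactly
   one representative of each place, so that an element v of MK is at once a
   place and the function |.|_v. *)
Definition is_normalized_places (R : realType) (K : fieldType)
    (MK : set (K -> R)) : Prop :=
  [/\ forall v, MK v ->
        [/\ is_absval v, nonarchimedean v & nontrivial_absval v],
      forall f : K -> R, is_absval f -> nontrivial_absval f ->
        exists! v, MK v /\ absval_equiv v f,
      forall v, MK v -> forall x, x != 0 -> ln (v x) \is a Num.int &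
      forall x, x != 0 -> finite_set (MK `&` [set v | v x != 1]) /\
        \big[*%R/1]_(v \in MK) v x = 1].

(* The value at 0 is irrelevant; see [vinf_div] for the usual formula. *)
Definition vinf (F : fieldType) (x : {fraction {poly F}}) : int :=
  (polydeg (frac (repr x)).2)%:Z - (polydeg (frac (repr x)).1)%:Z.

Lemma fracE (D : idomainType) (x : {fraction D}) :
  x = FracField.tofrac (frac (repr x)).1 / FracField.tofrac (frac (repr x)).2.
Proof.
have dx : FracField.tofrac (frac (repr x)).2 != 0 by rewrite tofrac_eq0 denom_ratioP.
apply: (mulIf dx); rewrite divfK//.
rewrite -{1}[x]reprK; unlock FracField.tofrac; rewrite -[LHS]FracField.pi_mul.
apply/eqmodP; rewrite /= FracField.equivfE /FracField.mulf.
by rewrite !numden_Ratio ?mulf_neq0 ?oner_neq0 ?denom_ratioP// !mulr1 mulrC.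
Qed.

Lemma vinf_div (F : fieldType) (f g : {poly F}) : f != 0 -> g != 0 ->
  vinf (FracField.tofrac f / FracField.tofrac g)
  = (polydeg g)%:Z - (polydeg f)%:Z.
Proof.
move=> f0 g0; rewrite /vinf; set x := _ / _.
have := fracE x; set n := (frac (repr x)).1; set d := (frac (repr x)).2.
have d0 : d != 0 by exact: denom_ratioP.
rewrite {1}/x => /eqP; rewrite eqr_div ?tofrac_eq0// -!tofracM tofrac_eq.
move=> /eqP fd; have n0 : n != 0.
  apply: contra_eq_neq fd => ->; rewrite mul0r; exact: mulf_neq0.
have := congr1 (fun p : {poly F} => size p) fd.
rewrite !size_mul// /polydeg; move: f0 g0 d0 n0; rewrite -!size_poly_gt0.
by case: (size f) (size g) (size n) (size d) => [|a] [|b] [|c] [|e]//= _ _ _ _; lia.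
Qed.

Definition absinf (R : realType) (F : fieldType) (x : {fraction {poly F}}) : R :=
  if x == 0 then 0 else expR (- (vinf x)%:~R).

(* v lies over v_infty. *)
Definition infinite_place (R : realType) (F : finFieldType)
    (K : fieldExtType {fraction {poly F}}) (v : K -> R) : Prop :=
  absval_equiv (@absinf R F) (fun x => v x%:A).

Definition S_integral (R : realType) (K : fieldType) (MK S : set (K -> R))
    (alpha beta : K) : Prop :=
  forall v, MK v -> ~ S v ->
    (v alpha <= 1 -> 1 <= v (alpha - beta)) /\ (1 < v alpha -> v beta <= 1).

(* Main.v *)
Require Import Defs.
From HB Require Import structures.
From mathcomp Require Import all_boot all_order all_algebra all_field finmap.
From mathcomp Require Import all_classical all_reals all_analysis.
From mathcomp Require Import ring zify.

Set Implicit Arguments.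
Unset Strict Implicit.
Unset Printing Implicit Defensive.

Import Order.TTheory GRing.Theory Num.Theory.
Local Open Scope classical_set_scope.
Local Open Scope ring_scope.

(* Write u = phi_Q(beta) - alpha and, for Q = t Q1 + c, y = phi_Q1(beta).  Outside a finite
   set T of places u has absolute value at least 1, as in Mason's proof of the abc theorem for
   function fields, where the role of the derivation is played by a K^p-linear map
   mu : K -> K, p being the characteristic, that kills exactly g K^p, where g is the leading
   coefficient of phi_t.  Such a map is bounded at every place and preserves integrality
   outside T, so mu u / u has bounded height; if mu u <> 0, the product formula then gives
   |u|_v << |mu u|_v for all v in T.  But mu commutes with p-th powers and kills g, so mu u is of
   lower degree in y than u, which bounds y; hence finitely many Q.

   If mu u = 0 for infinitely many Q, comparing degrees in y shows that t and all the
   coefficients of phi_t / g (beyond the constant one), beta / g and alpha / g are p-th powers in K.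
   The whole configuration is then the image under x |-> g x^p of a similar one with
   t replaced by t^(1/p).  This descent stops because the value of t at a place above v_infty is
   an integer that gets divided by p. *)

(** * Non-archimedean absolute values *)

Section AbsoluteValue.
Variables (R : realType) (K : fieldType) (v : K -> R).
Hypotheses (av : is_absval v) (na : nonarchimedean v).

Lemma absval_ge0 x : 0 <= v x. Proof. by case: av. Qed.

Lemma absval_eq0 x : (v x == 0) = (x == 0).
Proof. by case: av => _ v0 _ _; apply/eqP/eqP; apply v0. Qed.

Lemma absval0 : v 0 = 0. Proof. by apply/eqP; rewrite absval_eq0. Qed.

Lemma absval_gt0 x : (0 < v x) = (x != 0).
Proof. by rewrite lt_def absval_eq0 absval_ge0 andbT. Qed.

Lemma absvalM x y : v (x * y) = v x * v y. Proof. by case: av. Qed.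

Lemma absval1 : v 1 = 1.
Proof.
apply: (@mulfI _ (v 1)); first by rewrite absval_eq0 oner_eq0.
by rewrite -absvalM !mulr1.
Qed.

Lemma absvalX x n : v (x ^+ n) = v x ^+ n.
Proof. by elim: n => [|n IHn]; rewrite ?absval1 // !exprS absvalM IHn. Qed.

Lemma absvalV x : v x^-1 = (v x)^-1.
Proof.
have [->|x0] := eqVneq x 0; first by rewrite invr0 absval0 invr0.
apply: (@mulfI _ (v x)); first by rewrite absval_eq0.
by rewrite -absvalM !divff ?absval1 ?absval_eq0.
Qed.

Lemma absvalf_div x y : v (x / y) = v x / v y.
Proof. by rewrite absvalM absvalV. Qed.

Lemma absval_root_of_unity x n : x ^+ n.+1 = 1 -> v x = 1.
Proof.
move=> /(congr1 v); rewrite absvalX absval1 => /eqP.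
by rewrite pexpr_eq1 ?absval_ge0// => /eqP.
Qed.

Lemma absvalN x : v (- x) = v x.
Proof.
rewrite -mulN1r absvalM (@absval_root_of_unity _ 1) ?mul1r//.
by rewrite sqrrN expr1n.
Qed.

Lemma absvalD_le x y B : v x <= B -> v y <= B -> v (x + y) <= B.
Proof. by move=> xB yB; rewrite (le_trans (na x y))// ge_max xB yB. Qed.

Lemma absvalB_le x y B : v x <= B -> v y <= B -> v (x - y) <= B.
Proof. by move=> xB yB; apply: absvalD_le; rewrite ?absvalN. Qed.

Lemma absvalD_lt x y B : v x < B -> v y < B -> v (x + y) < B.
Proof. by move=> xB yB; rewrite (le_lt_trans (na x y))// gt_max xB yB. Qed.

Lemma absval_sum_le (I : Type) (s : seq I) (P : pred I) (f : I -> K) B :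
  0 <= B -> (forall i, P i -> v (f i) <= B) -> v (\sum_(i <- s | P i) f i) <= B.
Proof.
move=> B0 fB; elim/big_ind: _ => //; first by rewrite absval0.
by move=> x y; apply: absvalD_le.
Qed.

Lemma absval_sum_lt (I : Type) (s : seq I) (P : pred I) (f : I -> K) B :
  0 < B -> (forall i, P i -> v (f i) < B) -> v (\sum_(i <- s | P i) f i) < B.
Proof.
move=> B0 fB; elim/big_ind: _ => //; first by rewrite absval0.
by move=> x y; apply: absvalD_lt.
Qed.

Lemma absvalDl_eq x y : v y < v x -> v (x + y) = v x.
Proof.
move=> yx; apply/le_anti/andP; split; first by apply: absvalD_le => //; exact: ltW.
rewrite leNgt; apply/negP => xyx.
have : v (x + y - y) < v x by apply: absvalD_lt => //; rewrite absvalN.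
by rewrite addrK ltxx.
Qed.

(** The largest nonzero term strictly dominates all others, so the sum has its absolute value. *)
Lemma absval_sum_ge (I : finType) (f : I -> K) :
  (forall i j, i != j -> f i != 0 -> v (f i) != v (f j)) ->
  forall i, v (f i) <= v (\sum_j f j).
Proof.
move=> fneq i.
have [fi0|fi0] := eqVneq (f i) 0; first by rewrite fi0 absval0 absval_ge0.
pose m := [arg max_(j > i) v (f j)]%O.
have mmax j : v (f j) <= v (f m).
  by rewrite /m; case: arg_maxP => // k _; apply.
have fm0 : f m != 0 by rewrite -absval_gt0 (lt_le_trans _ (mmax i))// absval_gt0.
rewrite (le_trans (mmax i))// (bigD1 m)//= absvalDl_eq//.
apply: absval_sum_lt; first by rewrite absval_gt0.
by move=> j jm; rewrite lt_neqAle mmax andbT eq_sym fneq// eq_sym.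
Qed.

Lemma absval_coefs_bounded (P : {poly K}) : exists2 B, 0 <= B & forall i, v P`_i <= B.
Proof.
exists (\sum_(i < size P) v P`_i); first by apply: sumr_ge0 => i _; exact: absval_ge0.
move=> i; have [iP|iP] := ltnP i (size P).
  by rewrite (bigD1 (Ordinal iP))//= lerDl; apply: sumr_ge0 => j _; exact: absval_ge0.
by rewrite nth_default// absval0 sumr_ge0// => j _; exact: absval_ge0.
Qed.

(** The local factor of the height; its powers are nondecreasing in the exponent even where |x| <
    1. *)
Definition absmax1 (x : K) : R := Num.max 1 (v x).

Lemma absmax1_ge1 x : 1 <= absmax1 x. Proof. by rewrite le_max lexx. Qed.

Lemma absval_le_max1 x : v x <= absmax1 x. Proof. by rewrite le_max lexx orbT. Qed.

Lemma le_absmax1X x m n : (m <= n)%N -> absmax1 x ^+ m <= absmax1 x ^+ n.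
Proof. by move=> mn; apply: ler_weXn2l => //; exact: absmax1_ge1. Qed.

Lemma absval_horner_le (P : {poly K}) n : (size P <= n.+1)%N ->
  exists2 C, 0 <= C & forall y, v P.[y] <= C * absmax1 y ^+ n.
Proof.
move=> Pn; have [B B0 PB] := absval_coefs_bounded P; exists B => // y.
rewrite horner_coef; apply: absval_sum_le => [|i _].
  by rewrite mulr_ge0 ?exprn_ge0// (le_trans ler01)// absmax1_ge1.
rewrite absvalM absvalX ler_pM ?exprn_ge0 ?absval_ge0//.
apply: (@le_trans _ _ (absmax1 y ^+ i)).
  by rewrite lerXn2r ?nnegrE ?absval_ge0 ?absval_le_max1// (le_trans ler01)// absmax1_ge1.
by rewrite le_absmax1X// -ltnS (leq_trans _ Pn).
Qed.

(** Where |y| > 1, the leading term is [P.[y]] minus terms of lower degree, hence O(|y|^d), although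
    it has exact order |y|^(d+1). This bounds |y|. *)
Lemma absval_horner_small (P : {poly K}) d C : size P = d.+2 ->
  exists B, forall y, v P.[y] <= C * absmax1 y ^+ d -> v y <= B.
Proof.
move=> sP; have P0 : lead_coef P != 0 by rewrite lead_coef_eq0 -size_poly_gt0 sP.
pose Q := \poly_(i < d.+1) P`_i.
have [C' C'0 QC'] := @absval_horner_le Q d (size_poly _ _).
pose D := Num.max C C'; exists (Num.max 1 (D / v (lead_coef P))) => y PC.
have [|y1] := leP (v y) 1; first by rewrite le_max => ->.
have My : absmax1 y = v y by rewrite /absmax1 max_r// ltW.
have EP : lead_coef P * y ^+ d.+1 = P.[y] - Q.[y].
  rewrite horner_coef sP big_ord_recr /= lead_coefE sP /=.
  have -> : Q.[y] = \sum_(i < d.+1) P`_i * y ^+ i.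
    rewrite (@horner_coef_wide _ d.+1 Q) ?size_poly//.
    by apply: eq_bigr => i _; rewrite coef_poly ltn_ord.
  by rewrite [RHS]addrC addKr.
have : v (P.[y] - Q.[y]) <= D * v y ^+ d.
  have vd : 0 <= v y ^+ d by rewrite exprn_ge0// absval_ge0.
  rewrite -My; apply: absvalB_le.
    by rewrite (le_trans PC)// ler_wpM2r ?My// le_max lexx.
  by rewrite (le_trans (QC' y))// ler_wpM2r ?My// le_max lexx orbT.
rewrite -EP absvalM absvalX exprS mulrA ler_pM2r; last first.
  by rewrite exprn_gt0// (lt_trans ltr01).
by move=> H; rewrite le_max ler_pdivlMr ?absval_gt0// mulrC H orbT.
Qed.

End AbsoluteValue.

(** * Places and the product formula *)

Lemma prodr_ge1 (R : numDomainType) (I : eqType) (s : seq I) (f : I -> R) :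
  (forall i, i \in s -> 1 <= f i) -> 1 <= \prod_(i <- s) f i.
Proof.
move=> f1; rewrite big_seq; elim/big_rec: _ => // i y si y1.
by rewrite -[1]mulr1 ler_pM ?ler01// f1.
Qed.

Lemma le_prodr_mem (R : numDomainType) (I : eqType) (s : seq I) (f : I -> R) i :
  (forall j, j \in s -> 1 <= f j) -> i \in s -> f i <= \prod_(j <- s) f j.
Proof.
move=> f1 si; rewrite (big_rem i)//= ler_peMr//.
  by rewrite (le_trans ler01)// f1.
by apply: prodr_ge1 => j js; rewrite f1// (mem_rem js).
Qed.

Section Places.
Variables (R : realType) (K : fieldType) (MK : set (K -> R)).
Hypothesis hMK : is_normalized_places MK.

Lemma place_absval v : MK v -> is_absval v.
Proof. by case: hMK => + _ _ _ => /[apply] -[]. Qed.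

Lemma place_nonarch v : MK v -> nonarchimedean v.
Proof. by case: hMK => + _ _ _ => /[apply] -[]. Qed.

Lemma place_ln_int v x : MK v -> x != 0 -> ln (v x) \is a Num.int.
Proof. by case: hMK => _ _ + _ => /[apply] /[apply]. Qed.

Lemma finite_bad_places (l : seq K) : exists T : set (K -> R),
  [/\ T `<=` MK, finite_set T &
      forall v, MK v -> ~ T v -> forall z, z \in l -> v z <= 1].
Proof.
elim: l => [|z l [T [TMK finT Tl]]]; first by exists set0; split.
exists (T `|` (MK `&` [set v | 1 < v z])); split.
- by move=> v [/TMK|[]].
- rewrite finite_setU; split=> //.
  have [->|z0] := eqVneq z 0.
    rewrite (_ : _ `&` _ = set0)// -subset0 => v [Mv] /=.
    by rewrite (absval0 (place_absval Mv)) ltr10.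
  case: hMK => _ _ _ /(_ z z0)[+ _]; apply: sub_finite_set => v [Mv] /= vz.
  by split=> //=; rewrite gt_eqF.
- move=> v Mv /not_orP[vT vz] y; rewrite inE => /orP[/eqP ->|]; last exact: Tl.
  by rewrite leNgt; apply/negP => zv; apply: vz.
Qed.

(** The product over all places is 1, and the factors outside [T] are at most 1. *)
Lemma prod_places_ge1 (T : set (K -> R)) z : T `<=` MK -> finite_set T -> z != 0 ->
  (forall w, MK w -> ~ T w -> w z <= 1) -> 1 <= \prod_(w <- fset_set T) w z.
Proof.
move=> TMK finT z0 zT; case: hMK => _ _ _ /(_ z z0)[finD prod1].
apply: (@le_trans _ _ (\big[*%R/1]_(v \in MK) v z)); first by rewrite prod1.
set D := _ `&` _ in finD.
have finDT : finite_set (D `\` T) by exact: finite_setD.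
rewrite -(@fsbig_widen _ _ _ _ (T `|` (D `\` T))); last 2 first.
- by move=> w [/TMK|[[]]].
- move=> w [Mw /not_orP[Tw DTw]] /=; apply: contrapT => wz; apply: DTw.
  by split=> //; split=> //=; apply/eqP.
rewrite fsbigU0//= ?fsbig_finite//=; last by move=> w [Tw []].
rewrite ler_piMr//; last first.
  rewrite big_seq prodr_ile1// => w; rewrite in_fset_set// inE => -[[Mw _] Tw].
  by rewrite (absval_ge0 (place_absval Mw)) zT.
rewrite big_seq prodr_ge0// => w; rewrite in_fset_set// inE => /TMK Mw.
exact: (absval_ge0 (place_absval Mw)).
Qed.

(* By the product formula, upper bounds at all places give a lower bound at each of them. *)
Lemma prod_places_lower (T : set (K -> R)) (b : (K -> R) -> R) z : T `<=` MK ->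
    finite_set T -> z != 0 -> (forall w, MK w -> ~ T w -> w z <= 1) ->
    (forall w, T w -> w z <= b w) ->
  forall v, T v -> b v <= (\prod_(w <- fset_set T) b w) * v z.
Proof.
move=> TMK finT z0 zT zb v Tv.
have vz_gt0 w : T w -> 0 < w z.
  by move=> /TMK Mw; rewrite (absval_gt0 (place_absval Mw)).
have fP w : w \in fset_set T -> T w by rewrite in_fset_set// inE.
(* Each ratio [b w / w z] is at least 1, so the one at [v] is at most their product; the other
   factor, the product of the [w z], is at least 1. *)
have -> : \prod_(w <- fset_set T) b w =
    (\prod_(w <- fset_set T) (b w / w z)) * \prod_(w <- fset_set T) w z.
  rewrite -big_split /= big_seq [RHS]big_seq; apply: eq_bigr => w /fP Tw.
  by rewrite divfK// gt_eqF// vz_gt0.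
have f1 w : w \in fset_set T -> 1 <= b w / w z.
  by move=> /fP Tw; rewrite ler_pdivlMr ?mul1r ?zb// vz_gt0.
have vT : v \in fset_set T by rewrite in_fset_set// inE.
rewrite -ler_pdivrMr ?vz_gt0// (le_trans (le_prodr_mem f1 vT))//.
rewrite ler_peMr// ?prod_places_ge1//.
by rewrite (le_trans ler01)// prodr_ge1.
Qed.

End Places.

(** * Maps linear over p-th powers *)

Definition pth_linear (K : fieldType) (p : nat) (lam : K -> K) : Prop :=
  {morph lam : x y / x + y} /\ forall a x, lam (a ^+ p * x) = a ^+ p * lam x.

Section CharP.
Variables (K : fieldType) (p : nat).
Hypothesis charK : p \in GRing.pchar K.

Lemma prime_pcharP : prime p. Proof. exact: pcharf_prime charK. Qed.

Lemma exprD_pchar (x y : K) : (x + y) ^+ p = x ^+ p + y ^+ p.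
Proof. by rewrite exprDn_pchar// pnatE ?prime_pcharP. Qed.

Lemma exprB_pchar (x y : K) : (x - y) ^+ p = x ^+ p - y ^+ p.
Proof. by apply: (@addIr _ (y ^+ p)); rewrite -exprD_pchar !subrK. Qed.

Lemma exprN_pchar (x : K) : (- x) ^+ p = - x ^+ p.
Proof.
by rewrite -[- x]sub0r exprB_pchar expr0n gtn_eqF ?sub0r// prime_gt0// prime_pcharP.
Qed.

Lemma expr_pchar_inj : injective (fun x : K => x ^+ p).
Proof.
move=> x y /= xy; apply/eqP; rewrite -subr_eq0.
have : (x - y) ^+ p == 0 by rewrite exprB_pchar xy subrr.
by rewrite expf_eq0 => /andP[].
Qed.

Lemma expr_pchar_sum (I : Type) (s : seq I) (P : pred I) (f : I -> K) :
  (\sum_(i <- s | P i) f i) ^+ p = \sum_(i <- s | P i) f i ^+ p.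
Proof.
apply: (big_morph (fun x : K => x ^+ p) exprD_pchar).
by rewrite expr0n gtn_eqF// prime_gt0// prime_pcharP.
Qed.

Section PthLinear.
Variable lam : K -> K.
Hypothesis plam : pth_linear p lam.

Lemma pth_linearD : {morph lam : x y / x + y}. Proof. by case: plam. Qed.

Lemma pth_linearZ a x : lam (a ^+ p * x) = a ^+ p * lam x.
Proof. by case: plam. Qed.

Lemma pth_linear0 : lam 0 = 0.
Proof. by apply: (@addrI _ (lam 0)); rewrite -pth_linearD !addr0. Qed.

Lemma pth_linearB : {morph lam : x y / x - y}.
Proof.
by move=> x y; apply: (@addIr _ (lam y)); rewrite -pth_linearD !subrK.
Qed.

Lemma pth_linear_sum (I : Type) (s : seq I) (P : pred I) (f : I -> K) :
  lam (\sum_(i <- s | P i) f i) = \sum_(i <- s | P i) lam (f i).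
Proof. exact: (big_morph lam pth_linearD pth_linear0). Qed.

Lemma pth_linear_mul c : pth_linear p (fun x => lam (c * x)).
Proof.
by split=> [x y|a x]; [rewrite mulrDr pth_linearD | rewrite mulrCA pth_linearZ].
Qed.

(** The powers of [y ^+ p] are scalars for [lam]. *)
Lemma pth_linear_horner (P : {poly K}) y :
  lam P.[y ^+ p] = (map_poly lam P).[y ^+ p].
Proof.
rewrite horner_coef pth_linear_sum.
rewrite (@horner_coef_wide _ (size P) (map_poly lam P)) ?size_poly//.
apply: eq_bigr => i _; rewrite coef_map_id0 ?pth_linear0// -exprM mulnC exprM.
by rewrite mulrC pth_linearZ mulrC.
Qed.

End PthLinear.
End CharP.

(** * Expansions over K^p at a place, when K has dimension at most p over K^p *)

Section Uniformizer.
Variables (R : realType) (K : fieldType) (MK : set (K -> R)) (p : nat).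
Hypothesis hMK : is_normalized_places MK.
Hypothesis charK : p \in GRing.pchar K.
Hypothesis pdep : forall y : 'I_p.+1 -> K, exists a : 'I_p.+1 -> K,
  (exists i, a i != 0) /\ \sum_i a i ^+ p * y i = 0.

(** No multiple by 0 < k < p of the value of [s] is divisible by p in the value group, so 1, s, ...,
    s^(p-1) have values in distinct classes modulo p. *)
Definition p_uniformizer (v : K -> R) (s : K) : Prop := s != 0 /\
  forall c k, c != 0 -> (0 < k < p)%N -> v s ^+ k != v c ^+ p.

(** Take [s] with |ln v(s)| positive and of least p-adic valuation. If k ln v(s) = p ln v(c) with 0
    < k < p, then ln v(c) would have a smaller valuation still. *)
Lemma exists_p_uniformizer v : MK v -> exists s, p_uniformizer v s.
Proof.
move=> Mv; have av := place_absval hMK Mv; have pp := prime_pcharP charK.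
pose m x := `|Num.floor (ln (v x))|%N.
have lnv x : x != 0 -> ln (v x) = (Num.floor (ln (v x)))%:~R.
  by move=> x0; apply/eqP; rewrite eq_sym -intrEfloor (place_ln_int hMK).
have v_gt0 x : x != 0 -> 0 < v x by rewrite absval_gt0.
pose P n := `[< exists x, [/\ x != 0, (0 < m x)%N & logn p (m x) = n] >].
have exP : exists n, P n.
  have [_ _ [x [x0 vx]]] : [/\ is_absval v, nonarchimedean v & nontrivial_absval v].
    by case: hMK => /(_ v Mv).
  exists (logn p (m x)); apply/asboolP; exists x; split=> //.
  rewrite absz_gt0; apply: contra vx => /eqP fx.
  by rewrite -ln_eq0 ?v_gt0// lnv// fx.
case: (ex_minnP exP) => n /asboolP[s [s0 ms msn]] minn.
exists s; split=> // c k c0 /andP[k0 kp]; apply/eqP => vsc.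
have : (k%:Z * Num.floor (ln (v s)))%:~R = (p%:Z * Num.floor (ln (v c)))%:~R :> R.
  rewrite !intrM -!lnv// -!pmulrn.
  by rewrite !mulr_natl -!lnXn ?v_gt0// vsc.
move=> /intr_inj/(congr1 absz); rewrite !abszM /= => E0.
have {E0}E : (k * m s = p * m c)%N by [].
have mc : (0 < m c)%N.
  rewrite lt0n; apply/eqP => mc0; move: E; rewrite mc0 muln0 => /eqP.
  by rewrite muln_eq0 (gtn_eqF k0) (gtn_eqF ms).
have := congr1 (logn p) E; rewrite !lognM ?(prime_gt0 pp)// msn.
rewrite (logn_prime p pp) eqxx (@logn_coprime p k); last first.
  by rewrite prime_coprime// gtnNdvd.
have : (n <= logn p (m c))%N by apply: minn; apply/asboolP; exists c; split.
lia.
Qed.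

Section Basis.
Variables (v : K -> R) (s : K).
Hypotheses (Mv : MK v) (hs : p_uniformizer v s).

(** Two nonzero terms cannot have the same absolute value: their quotient would make some s^k with 0
    < k < p agree in value with a p-th power. So [absval_sum_ge] applies. *)
Lemma p_uniformizer_orth (a : 'I_p -> K) k :
  v (a k ^+ p * s ^+ k) <= v (\sum_(j < p) a j ^+ p * s ^+ j).
Proof.
have av := place_absval hMK Mv; have [s0 hvs] := hs.
apply: (@absval_sum_ge _ _ _ av (place_nonarch hMK Mv) _ (fun j : 'I_p => a j ^+ p * s ^+ j)).
have pp := prime_gt0 (prime_pcharP charK).
have vs0 n : v s ^+ n != 0 by rewrite expf_neq0// (absval_eq0 av).
have main (i j : 'I_p) : (i < j)%N -> a i != 0 -> a j != 0 ->
    v (a i ^+ p * s ^+ i) != v (a j ^+ p * s ^+ j).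
  move=> ij ai aj; apply/eqP; rewrite !(absvalM av)// !(absvalX av)// => E.
  have jip : (0 < j - i < p)%N.
    by rewrite subn_gt0 ij (leq_ltn_trans (leq_subr _ _)).
  have /eqP := hvs (a i / a j) (j - i)%N (mulf_neq0 ai (invr_neq0 aj)) jip; apply.
  apply: (mulIf (vs0 i)); rewrite -exprD subnK ?(ltnW ij)//.
  rewrite (absvalf_div av)// expr_div_n mulrAC E mulrAC divff ?mul1r//.
  by rewrite expf_neq0// (absval_eq0 av).
move=> i j ij; rewrite mulf_eq0 negb_or !expf_eq0 pp /= => /andP[ai _].
have [aj0|aj] := eqVneq (a j) 0.
  rewrite aj0 expr0n gtn_eqF// mul0r (absval0 av)// (absval_eq0 av)//.
  by rewrite mulf_neq0// expf_neq0.
case: (ltngtP i j) => [lt_ij|lt_ji|/val_inj/eqP]; first exact: main.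
- by rewrite eq_sym; apply: main.
- by rewrite (negPf ij).
Qed.

(** The p + 1 elements [b], 1, s, ..., s^(p-1) satisfy a relation over K^p, and by orthogonality it
    must involve [b]. *)
Lemma p_uniformizer_span b : exists a : 'I_p -> K, b = \sum_(j < p) a j ^+ p * s ^+ j.
Proof.
have pp := prime_gt0 (prime_pcharP charK); have av := place_absval hMK Mv.
pose y (i : 'I_p.+1) := if unlift ord0 i is Some k then s ^+ (k : nat) else b.
have [a [[i ai] /eqP]] := pdep y.
rewrite big_ord_recl /y unlift_none.
under eq_bigr do rewrite liftK.
have [a00|a0] := eqVneq (a ord0) 0.
  rewrite a00 expr0n gtn_eqF// mul0r add0r => /eqP E; case: (unliftP ord0 i) => [j|] Ei; last first.
    by rewrite Ei a00 eqxx in ai.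
  have := p_uniformizer_orth (fun k => a (lift ord0 k)) j.
  have s0 : s != 0 by case: hs.
  rewrite E (absval0 av)// leNgt (absval_gt0 av)// mulf_neq0// expf_neq0//.
  by rewrite -Ei.
rewrite addr_eq0 => /eqP E; exists (fun k => - (a (lift ord0 k) / a ord0)).
apply: (mulfI (expf_neq0 p a0)); rewrite E mulr_sumr -sumrN.
apply: eq_bigr => k _; rewrite exprN_pchar// expr_div_n mulNr mulrN; congr (- _).
by rewrite -[in RHS]mulrA [RHS]mulrCA mulVKf// expf_neq0.
Qed.

(** In the expansion of [b] over the powers of [s] no term exceeds [b], so it suffices to bound
    [lam] on these p powers. *)
Lemma pth_linear_bounded lam : pth_linear p lam ->
  exists2 C, 1 <= C & forall b, v (lam b) <= C * v b.
Proof.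
move=> plam; have av := place_absval hMK Mv; have na := place_nonarch hMK Mv.
have s0 : s != 0 by case: hs.
pose C := 1 + \sum_(k < p) v (lam (s ^+ k)) / v s ^+ k.
have t0 (k : 'I_p) : 0 <= v (lam (s ^+ k)) / v s ^+ k.
  by rewrite divr_ge0 ?exprn_ge0 ?(absval_ge0 av).
exists C => [|b]; first by rewrite lerDl sumr_ge0.
have [a ->] := p_uniformizer_span b; rewrite (pth_linear_sum plam).
apply: (absval_sum_le av na) => // [|k _].
  by rewrite mulr_ge0 ?(absval_ge0 av)// addr_ge0// sumr_ge0.
rewrite (pth_linearZ plam) (absvalM av)//.
apply: (@le_trans _ _ (v (lam (s ^+ k)) / v s ^+ k * v (a k ^+ p * s ^+ k))).
  by rewrite (absvalM av)// !(absvalX av)// mulrCA divfK ?lexx// expf_neq0// (absval_eq0 av).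
rewrite ler_pM ?(absval_ge0 av) ?p_uniformizer_orth//.
by rewrite /C (bigD1 k)//= addrCA lerDl addr_ge0// sumr_ge0.
Qed.

(** The map subtracts from [b] its component along s^0 = 1 in the basis of powers of [s]; what it
    kills is the line K^p. *)
Lemma exists_pth_linear : exists lam : K -> K, [/\ pth_linear p lam,
  forall a, lam (a ^+ p) = 0 & forall b, lam b = 0 -> exists a, b = a ^+ p].
Proof.
have pp := prime_gt0 (prime_pcharP charK); pose o := Ordinal pp.
have av := place_absval hMK Mv; have s0 : s != 0 by case: hs.
pose coord b := sval (cid (p_uniformizer_span b)).
have coordE b : b = \sum_(j < p) coord b j ^+ p * s ^+ j.
  by rewrite /coord; case: cid.
(* [coord] is an arbitrary choice of coefficients; orthogonality, applied to the difference of two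
   expansions of [b], shows that its value at index 0 is forced. *)
have coord_uniq b a : b = \sum_(j < p) a j ^+ p * s ^+ j -> coord b o = a o.
  move=> E; apply/eqP; rewrite -subr_eq0; apply/negPn/negP => ao.
  have := p_uniformizer_orth (fun j => coord b j - a j) o.
  under [X in _ <= v X]eq_bigr do rewrite exprB_pchar// mulrBl.
  rewrite sumrB -coordE -E subrr (absval0 av)// expr0 mulr1 leNgt (absval_gt0 av)//.
  by rewrite expf_neq0.
have sum_o b : \sum_(j < p) (if j == o then b else 0) ^+ p * s ^+ j = b ^+ p.
  rewrite (bigD1 o)//= expr0 mulr1 big1 ?addr0// => j /negPf ->.
  by rewrite expr0n gtn_eqF// mul0r.
exists (fun b => b - coord b o ^+ p); split.
- split=> [x y|a x].
    rewrite (@coord_uniq _ (fun j => coord x j + coord y j)); last first.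
      rewrite {1}(coordE x) {1}(coordE y) -big_split.
      by apply: eq_bigr => j _; rewrite exprD_pchar// mulrDl.
    by rewrite exprD_pchar// opprD addrACA.
  rewrite (@coord_uniq _ (fun j => a * coord x j)); last first.
    rewrite {1}(coordE x) mulr_sumr.
    by apply: eq_bigr => j _; rewrite exprMn mulrA.
  by rewrite exprMn mulrBr.
- move=> a; rewrite (@coord_uniq _ (fun j => if j == o then a else 0)); first by rewrite eqxx subrr.
  by rewrite sum_o.
- by move=> b /eqP; rewrite subr_eq0 => /eqP bE; exists (coord b o).
Qed.

End Basis.
End Uniformizer.

(** * Integral points in additive orbits *)

Section ShiftedPower.
Variables (K : fieldType) (p : nat).
Hypothesis p0 : (0 < p)%N.

Lemma size_comp_polyXn (P : {poly K}) : P != 0 ->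
  size (P \Po 'X^p) = ((size P).-1 * p).+1.
Proof.
move=> P0; have := size_comp_poly P 'X^p; rewrite size_polyXn /= => <-.
rewrite prednK// lt0n size_poly_eq0 comp_poly_eq0 ?size_polyXn//.
Qed.

Lemma horner_comp_polyXn (P : {poly K}) y : (P \Po 'X^p).[y] = P.[y ^+ p].
Proof. by rewrite horner_comp hornerXn. Qed.

End ShiftedPower.

Section AbsvalBounds.
Variables (R : realType) (K : fieldType) (v : K -> R).
Hypotheses (av : is_absval v) (na : nonarchimedean v).

Lemma absval_triangle x y : v (x + y) <= v x + v y.
Proof. by case: av. Qed.

Lemma absval_triangleB x y : v (x - y) <= v x + v y.
Proof. by rewrite -(absvalN av y) absval_triangle. Qed.

Lemma absval_horner_le1 (P : {poly K}) y :
  (forall i, v P`_i <= 1) -> v y <= 1 -> v P.[y] <= 1.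
Proof.
move=> P1 y1; rewrite horner_coef; apply: (absval_sum_le av na) => // i _.
by rewrite absvalM// absvalX// mulr_ile1 ?exprn_ge0 ?exprn_ile1 ?absval_ge0.
Qed.

End AbsvalBounds.

(** * Abstract orbits Q |-> phi_Q(beta) *)

Section Orbit.
Variables (F : finFieldType) (K : fieldType) (p m : nat).

(** This models x(Q) = phi_Q(beta), with phi_t(y) = th y + Th(y^p) and q = p m. The recorded
    properties are those inherited by p-th roots: in the descent [th] is replaced by its p-th root
    and [iota] by its m-th power. *)
Definition additive_orbit (th : K) (Th : {poly K}) (iota : F -> K)
    (x : {poly F} -> K) : Prop :=
  [/\ {morph x : P Q / P + Q}, injective x,
      forall Q, x (Q * 'X) = th * x Q + Th.[x Q ^+ p],
      forall c Q, x (c%:P * Q) = iota c * x Q &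
      forall c, iota c ^+ (p * m) = iota c].

Variables (th : K) (Th : {poly K}) (iota : F -> K) (x : {poly F} -> K).
Hypothesis orb : additive_orbit th Th iota x.

Lemma orbitD : {morph x : P Q / P + Q}. Proof. by case: orb. Qed.

Lemma orbit_inj : injective x. Proof. by case: orb. Qed.

Lemma orbitMX Q : x (Q * 'X) = th * x Q + Th.[x Q ^+ p]. Proof. by case: orb. Qed.

Lemma orbitC c Q : x (c%:P * Q) = iota c * x Q. Proof. by case: orb. Qed.

Lemma orbit0 : x 0 = 0.
Proof. by apply: (@addrI _ (x 0)); rewrite -orbitD !addr0. Qed.

Lemma orbitMXaddC Q c : x (Q * 'X + c%:P) = th * x Q + Th.[x Q ^+ p] + x c%:P.
Proof. by rewrite orbitD orbitMX. Qed.

Lemma orbit_coef0 : (0 < p)%N -> Th`_0 = 0.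
Proof.
move=> p0; have := orbitMX 0.
by rewrite mul0r orbit0 mulr0 add0r expr0n gtn_eqF// horner_coef0.
Qed.

(* Dropping the constant coefficient is finite-to-one on F[t]. *)
Lemma orbit_finite (G : set {poly F}) (A : set K) : finite_set A ->
  (forall Q c, G (Q * 'X + c%:P) -> A (x Q)) -> finite_set G.
Proof.
move=> finA GA.
pose B := (x @^-1` A) `*` [set: F].
apply: (@sub_finite_set _ _ ((fun u : {poly F} * F => u.1 * 'X + u.2%:P) @` B)).
  move=> Q GQ; elim/poly_ind: Q GQ => [|Q c _] GQ; last first.
    by exists (Q, c) => //; split=> //=; apply: (GA _ c).
  exists (0, 0); last by rewrite /= mul0r addr0.
  by split=> //=; apply: (GA _ 0); rewrite mul0r addr0.
apply: finite_image; apply: finite_setX; last exact: finite_finset.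
by apply: finite_preimage => // P Q _ _; exact: orbit_inj.
Qed.

Lemma orbit_le1 (R : realType) (v : K -> R) : is_absval v -> nonarchimedean v ->
  v th <= 1 -> (forall i, v Th`_i <= 1) -> (forall c, v (x c%:P) <= 1) ->
  forall Q, v (x Q) <= 1.
Proof.
move=> av na v1 vTh vc; elim/poly_ind => [|Q c IH]; first by rewrite orbit0 (absval0 av).
rewrite orbitMXaddC; apply: (absvalD_le na) => //; apply: (absvalD_le na).
  by rewrite (absvalM av) mulr_ile1 ?absval_ge0.
by apply: absval_horner_le1 => //; rewrite (absvalX av) exprn_ile1 ?absval_ge0.
Qed.

End Orbit.

(** * Finiteness of integral points and the descent *)

Section Core.
Variables (R : realType) (F : finFieldType) (K : fieldType) (MK : set (K -> R)).
Variables (p m : nat).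
Hypothesis hMK : is_normalized_places MK.
Hypothesis charK : p \in GRing.pchar K.
Hypothesis pdep : forall y : 'I_p.+1 -> K, exists a : 'I_p.+1 -> K,
  (exists i, a i != 0) /\ \sum_i a i ^+ p * y i = 0.
Hypothesis northcott : forall (T : set (K -> R)) (B : (K -> R) -> R),
  T `<=` MK -> finite_set T ->
  finite_set [set y | (forall w, MK w -> ~ T w -> w y <= 1) /\
                      (forall w, T w -> w y <= B w)].

Let p_prime : prime p := prime_pcharP charK.
Let p_gt0 : (0 < p)%N := prime_gt0 p_prime.

Lemma place_pth_linear_bounded v mu : MK v -> pth_linear p mu ->
  exists2 C, 1 <= C & forall b, v (mu b) <= C * v b.
Proof.
move=> Mv; have [s hs] := exists_p_uniformizer hMK charK Mv.
exact: (pth_linear_bounded hMK charK pdep Mv hs).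
Qed.

Section OneOrbit.
Variables (th : K) (Th : {poly K}) (iota : F -> K) (x : {poly F} -> K).
Hypothesis orb : additive_orbit p m th Th iota x.

(** Integrality of these finitely many elements makes the whole orbit integral. The entry 0 is the
    default value of the coefficients of [Th] beyond its degree. *)
Definition orbit_data : seq K := [:: th, 0 & Th] ++ [seq x c%:P | c : F].

Lemma orbit_data_coef i : Th`_i \in orbit_data.
Proof.
rewrite !inE mem_cat; have [iT|iT] := ltnP i (size Th); last first.
  by rewrite nth_default// eqxx orbT.
by rewrite mem_nth// !orbT.
Qed.

Lemma orbit_data_const c : x c%:P \in orbit_data.
Proof. by rewrite mem_cat; apply/orP; right; apply/mapP; exists c; rewrite ?mem_enum. Qed.

Lemma orbit_data_le1 v : MK v -> (forall z, z \in orbit_data -> v z <= 1) ->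
  forall Q, v (x Q) <= 1.
Proof.
move=> Mv l1; apply: (orbit_le1 orb (place_absval hMK Mv) (place_nonarch hMK Mv)).
- by apply: l1; rewrite inE eqxx.
- by move=> i; apply: l1; exact: orbit_data_coef.
- by move=> c; apply: l1; exact: orbit_data_const.
Qed.

(** For Q = t Q1 + c and y = x(Q1), [mu (x Q)] is Psi(y^p) plus terms at most linear in y, where Psi
    = [map_poly mu Th] is not constant. As Psi(y^p) has degree at least 2, a fixed value of
    [mu (x Q)] bounds y at the bad places, and [northcott] concludes. *)
Lemma orbit_fibre_finite mu i kappa : pth_linear p mu -> (0 < i)%N ->
  mu Th`_i != 0 -> finite_set [set Q | mu (x Q) = kappa].
Proof.
move=> pmu i0 mui.
have [T [TMK finT T1]] := finite_bad_places hMK orbit_data.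
pose Psi := map_poly mu Th.
have Psi_i : Psi`_i != 0 by rewrite coef_map_id0 ?(pth_linear0 pmu).
have Psi_size : (1 < size Psi)%N.
  rewrite ltnNge; apply: contra Psi_i => sPsi.
  by rewrite nth_default// (leq_trans sPsi).
have Psi0 : Psi != 0 by rewrite -size_poly_gt0 (ltn_trans _ Psi_size).
(* [d] is one less than the degree of Psi(y^p), written as a successor so that it is visibly at
   least 1. *)
pose d := ((size Psi).-1 * p).-2.+1.
have hd : size (Psi \Po 'X^p) = d.+2.
  have : (2 <= (size Psi).-1 * p)%N.
    by rewrite (leq_trans (prime_gt1 p_prime))// leq_pmull// -subn1 subn_gt0.
  by rewrite size_comp_polyXn// /d; lia.
have bound w : exists B, T w -> forall Q c,
    mu (x (Q * 'X + c%:P)) = kappa -> w (x Q) <= B.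
  have [/TMK Mw|nTw] := pselect (T w); last by exists 0.
  have av := place_absval hMK Mw; have na := place_nonarch hMK Mw.
  have [C C1 muC] := place_pth_linear_bounded Mw pmu.
  pose D := w kappa + C * w th + \sum_(c : F) w (mu (x c%:P)).
  have [B PB] := absval_horner_small av na D hd.
  exists B => _ Q c E; apply: PB; rewrite horner_comp_polyXn.
  set y := x Q in E *.
  have -> : Psi.[y ^+ p] = kappa - mu (th * y) - mu (x c%:P).
    rewrite -(pth_linear_horner pmu) -E (orbitMXaddC orb) !(pth_linearD pmu).
    by ring.
  have M1 : 1 <= absmax1 w y ^+ d by rewrite exprn_ege1// absmax1_ge1.
  have yM : w y <= absmax1 w y ^+ d.
    rewrite (le_trans (absval_le_max1 w y))// -[leLHS]expr1 le_absmax1X//.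
  apply: (le_trans (absval_triangleB av _ _)); rewrite mulrDl lerD//.
    apply: (le_trans (absval_triangleB av _ _)); rewrite mulrDl lerD//.
      by rewrite ler_peMr ?absval_ge0.
    rewrite (le_trans (muC _))// (absvalM av) mulrA ler_wpM2l//.
    by rewrite mulr_ge0 ?absval_ge0// (le_trans ler01).
  rewrite (bigD1 c)//= -[leLHS]mulr1 ler_pM ?absval_ge0//.
  by rewrite lerDl sumr_ge0// => e _; rewrite absval_ge0.
have [B TB] := choice bound.
apply: (orbit_finite orb (northcott B TMK finT)) => Q c /= E; split=> w Mw.
  by move=> nTw; apply: (orbit_data_le1 Mw); exact: T1.
exact: (TB w Mw _ c).
Qed.

(** As [mu] is linear over K^p only, an induction on Q has to carry the products with [th ^+ k]; the
    range k < p is enough because [th ^+ p] passes through [mu]. *)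
Definition pth_linear_data (mu : K -> K) : seq K :=
  orbit_data ++ [seq mu (th ^+ k * z) | k <- index_iota 0 p, z <- orbit_data].

Lemma pth_linear_data_le1 mu v : pth_linear p mu -> MK v ->
    (forall z, z \in pth_linear_data mu -> v z <= 1) ->
  forall Q k, (k < p)%N -> v (mu (th ^+ k * x Q)) <= 1.
Proof.
move=> pmu Mv l1; have av := place_absval hMK Mv; have na := place_nonarch hMK Mv.
have {l1} [l1 mul1] : (forall z, z \in orbit_data -> v z <= 1) /\
    forall k z, (k < p)%N -> z \in orbit_data -> v (mu (th ^+ k * z)) <= 1.
  split=> [z zl|k z kp zl]; apply: l1; rewrite mem_cat ?zl//.
  apply/orP; right; apply/allpairsP; exists (k, z); split=> //.
  by rewrite mem_index_iota.
have x1 := orbit_data_le1 Mv l1.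
elim/poly_ind => [|Q c IH] k kp.
  by rewrite (orbit0 orb) mulr0 (pth_linear0 pmu) (absval0 av).
rewrite (orbitMXaddC orb) !mulrDr !(pth_linearD pmu).
apply: (absvalD_le na); last by apply: mul1 => //; exact: orbit_data_const.
apply: (absvalD_le na).
  rewrite mulrA -exprSr; have [kp1|] := ltnP k.+1 p; first exact: IH.
  rewrite leq_eqVlt ltnS leqNgt kp orbF => /eqP <-.
  rewrite (pth_linearZ pmu) (absvalM av) (absvalX av) mulr_ile1 ?exprn_ge0 ?(absval_ge0 av)//.
    by rewrite exprn_ile1 ?(absval_ge0 av)// l1// inE eqxx.
  by have := IH 0%N p_gt0; rewrite expr0 mul1r.
have pmuk := pth_linear_mul pmu (th ^+ k).
rewrite (pth_linear_horner pmuk); apply: absval_horner_le1 => // [i|].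
  rewrite coef_map_id0 ?(pth_linear0 pmuk)//; apply: mul1 => //.
  exact: orbit_data_coef.
by rewrite (absvalX av) exprn_ile1 ?(absval_ge0 av).
Qed.

(* For such Q the quotient mu u / u, where u = x Q - alpha, is bounded at every
   place; by the product formula u is then at most as large as mu u, which has
   lost the leading term of u. *)
Lemma orbit_integral_finite_pth_linear mu alpha (S : set (K -> R)) :
    pth_linear p mu -> (1 < size Th)%N -> mu (lead_coef Th) = 0 ->
    finite_set S -> S `<=` MK ->
  finite_set [set Q | (forall v, MK v -> ~ S v -> 1 <= v (x Q - alpha)) /\
                      mu (x Q - alpha) != 0].
Proof.
move=> pmu sTh muTh finS SMK.
have [T0 [T0MK finT0 T01]] := finite_bad_places hMK (mu alpha :: pth_linear_data mu).
pose T := S `|` T0.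
have TMK : T `<=` MK by move=> v [/SMK|/T0MK].
have finT : finite_set T by rewrite finite_setU.
have T1 v : MK v -> ~ T v -> forall z, z \in mu alpha :: pth_linear_data mu -> v z <= 1.
  by move=> Mv /not_orP[_]; exact: T01.
have Th0 : Th != 0 by rewrite -size_poly_gt0 (ltn_trans _ sTh).
pose d := ((size Th).-1 * p).-1.
have sTp : (2 <= (size Th).-1 * p)%N.
  by rewrite (leq_trans (prime_gt1 p_prime))// leq_pmull// -subn1 subn_gt0.
have hd : size (Th \Po 'X^p) = d.+2 by rewrite size_comp_polyXn// /d; lia.
pose Psi := map_poly mu Th.
(* The degree drops because [mu] kills the leading coefficient of [Th]. *)
have hPsi : (size (Psi \Po 'X^p) <= d.+1)%N.
  have [->|Psi0] := eqVneq Psi 0; first by rewrite comp_poly0 size_poly0.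
  rewrite size_comp_polyXn// ltnS /d.
  have : (size Psi < size Th)%N.
    have := lead_coef_eq0 Psi; rewrite (negPf Psi0) => /negbT; apply: contraR.
    rewrite -leqNgt => le_size.
    have -> : lead_coef Psi = mu (lead_coef Th); last by rewrite muTh.
    rewrite !lead_coefE; have -> : size Psi = size Th.
      by apply/eqP; rewrite eqn_leq le_size size_poly.
    by rewrite coef_map_id0 ?(pth_linear0 pmu).
  have := prime_gt1 p_prime; nia.
have boundC w : exists C, T w -> 1 <= C /\ forall b, w (mu b) <= C * w b.
  have [/TMK Mw|nTw] := pselect (T w); last by exists 0.
  by have [C C1 muC] := place_pth_linear_bounded Mw pmu; exists C.
have [C TC] := choice boundC.
pose D := \prod_(w <- fset_set T) C w.
have bound w : exists B, T w -> forall Q c,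
    w (x (Q * 'X + c%:P) - alpha) <= D * w (mu (x (Q * 'X + c%:P) - alpha)) ->
    w (x Q) <= B.
  have [Tw|nTw] := pselect (T w); last by exists 0.
  have Mw := TMK w Tw.
  have av := place_absval hMK Mw; have na := place_nonarch hMK Mw.
  have [Cw1 muC] := TC w Tw.
  have D0 : 0 <= D.
    rewrite /D big_seq prodr_ge0// => w'; rewrite in_fset_set// inE => /TC[C1 _].
    exact: le_trans ler01 C1.
  have [E E0 PE] := absval_horner_le av na hPsi.
  (* The bracket bounds |mu u| relative to M = max(1, |y|)^d. Since Th(y^p) = u - th y - x(c) +
     alpha and |u| <= D |mu u|, [A * M] bounds Th(y^p), which has degree d + 1 in y. *)
  pose A := D * (E + C w * w th + \sum_(c : F) w (mu (x c%:P)) + w (mu alpha))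
    + w th + \sum_(c : F) w (x c%:P) + w alpha.
  have [B PB] := absval_horner_small av na A hd.
  exists B => _ Q c uD; apply: PB; rewrite horner_comp_polyXn.
  move: uD; set u := _ - alpha; set y := x Q => uD.
  have M1 : 1 <= absmax1 w y ^+ d by rewrite exprn_ege1// absmax1_ge1.
  set M := absmax1 w y ^+ d in M1 *.
  have yM : w y <= M.
    apply: (le_trans (absval_le_max1 w y)); rewrite -[leLHS]expr1 le_absmax1X//.
    by rewrite /d -ltnS prednK// (leq_trans _ sTp).
  have constM z : w z <= w z * M by rewrite ler_peMr// (absval_ge0 av).
  have linM c' : 0 <= c' -> c' * w y <= c' * M by move=> c'0; rewrite ler_wpM2l.
  have sum_ge (f : F -> K) : w (f c) <= \sum_e w (f e).
    by rewrite (bigD1 c)//= lerDl sumr_ge0// => e _; rewrite (absval_ge0 av).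
  have EPsi : mu u = Psi.[y ^+ p] + mu (th * y) + mu (x c%:P) - mu alpha.
    rewrite -(pth_linear_horner pmu) /u (orbitMXaddC orb) (pth_linearB pmu).
    by rewrite !(pth_linearD pmu); ring.
  have ETh : Th.[y ^+ p] = u - th * y - x c%:P + alpha.
    by rewrite /u (orbitMXaddC orb) -/y; ring.
  have muuM : w (mu u) <= (E + C w * w th + \sum_(e : F) w (mu (x e%:P)) + w (mu alpha)) * M.
    rewrite EPsi !mulrDl; apply: (le_trans (absval_triangleB av _ _)); apply: lerD => //.
    apply: (le_trans (absval_triangle av _ _)); apply: lerD; last first.
      apply: (le_trans (constM _)); rewrite ler_wpM2r ?(sum_ge (fun e => mu (x e%:P)))//.
      exact: le_trans ler01 M1.
    apply: (le_trans (absval_triangle av _ _)); apply: lerD.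
      by have := PE y; rewrite horner_comp_polyXn.
    rewrite (le_trans (muC _))// (absvalM av) mulrA linM// mulr_ge0 ?(absval_ge0 av)//.
    exact: le_trans ler01 Cw1.
  rewrite ETh /A !mulrDl; apply: (le_trans (absval_triangle av _ _)); apply: lerD => //.
  apply: (le_trans (absval_triangleB av _ _)); apply: lerD; last first.
    apply: (le_trans (constM _)); rewrite ler_wpM2r ?(sum_ge (fun e => x e%:P))//.
    exact: le_trans ler01 M1.
  apply: (le_trans (absval_triangleB av _ _)); apply: lerD; last first.
    by rewrite (absvalM av) linM// (absval_ge0 av).
  by rewrite -mulrA (le_trans uD)// ler_wpM2l.
have [B TB] := choice bound.
apply: (orbit_finite orb (northcott B TMK finT)) => Q c /= [S1 mu0]; split=> w.
  move=> Mw nTw; apply: (orbit_data_le1 Mw) => z zl; apply: (T1 w Mw nTw).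
  by rewrite inE mem_cat zl orbT.
move=> Tw; apply: (TB w Tw _ c).
set u := x _ - alpha in S1 mu0 *.
have u0 : u != 0 by apply: contraNneq mu0 => ->; rewrite (pth_linear0 pmu).
have zC v : T v -> v (mu u / u) <= C v.
  move=> Tv; have av := place_absval hMK (TMK v Tv).
  by rewrite (absvalf_div av) ler_pdivrMr ?(absval_gt0 av)//; case: (TC v Tv).
have z1 v : MK v -> ~ T v -> v (mu u / u) <= 1.
  move=> Mv nTv; have av := place_absval hMK Mv; have na := place_nonarch hMK Mv.
  have u1 : 1 <= v u by apply: S1 => // Sv; apply: nTv; left.
  rewrite (absvalf_div av) ler_pdivrMr ?(absval_gt0 av)// mul1r (le_trans _ u1)//.
  rewrite (pth_linearB pmu); apply: (absvalB_le av na); last first.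
    by apply: (T1 v Mv nTv); rewrite inE eqxx.
  rewrite -[x _]mul1r -(expr0 th); apply: (pth_linear_data_le1 pmu Mv) => // z zl.
  by apply: (T1 v Mv nTv); rewrite inE zl orbT.
(* The quotient mu u / u is at most [C v] on [T] and at most 1 elsewhere, so it is at least
   [C w / D] at [w]; as [C w] is at least 1, this gives |u| <= D |mu u|. *)
have := prod_places_lower hMK TMK finT (mulf_neq0 mu0 (invr_neq0 u0)) z1 zC Tw.
have av := place_absval hMK (TMK w Tw).
rewrite -/D (absvalf_div av) mulrA ler_pdivlMr ?(absval_gt0 av)//; apply: le_trans.
by rewrite ler_peMl ?(absval_ge0 av)//; case: (TC w Tw).
Qed.

End OneOrbit.

(** Induction on [N], a strict bound for the positive integer ln |th| at [v0]. The orbit, [alpha]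
    and [S] are replaced in the descent and so are quantified after [N]. *)
Lemma orbit_integral_finite v0 : MK v0 -> (0 < m)%N -> forall N th (Th : {poly K})
    (iota : F -> K) (x : {poly F} -> K) alpha S,
    additive_orbit p m th Th iota x -> (1 < size Th)%N ->
    1 < v0 th -> ln (v0 th) < N%:R -> finite_set S -> S `<=` MK ->
  finite_set [set Q | forall v, MK v -> ~ S v -> 1 <= v (x Q - alpha)].
Proof.
move=> Mv0 m_gt0; have av0 := place_absval hMK Mv0; have na0 := place_nonarch hMK Mv0.
have [s hs] := exists_p_uniformizer hMK charK Mv0.
have [lam [plam lam0 lam_ker]] := exists_pth_linear hMK charK pdep Mv0 hs.
elim=> [|N IH] th Th iota x alpha S orb sTh th1 thN finS SMK.
  by move: thN; rewrite ltNge ltW// ln_gt0.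
pose g := lead_coef Th.
have g0 : g != 0 by rewrite lead_coef_eq0 -size_poly_gt0 (ltn_trans _ sTh).
pose mu b := lam (g^-1 * b).
have pmu : pth_linear p mu := pth_linear_mul plam g^-1.
have mu_ker b : mu b = 0 -> exists a, b = g * a ^+ p.
  by move=> /lam_ker[a E]; exists a; rewrite -E mulVKf.
have mu_g : mu g = 0 by rewrite /mu mulVf// -(expr1n _ p) lam0.
set G := [set Q | _]; apply: contrapT => infG.
(* Integral points outside [Z] are finite in number by the preceding lemma, so [Z] is infinite;
   below, each failure of a p-th power condition makes [Z] finite. *)
pose Z := [set Q | mu (x Q) = mu alpha].
have infZ : ~ finite_set Z.
  move=> finZ; apply: infG.
  have fin1 := orbit_integral_finite_pth_linear orb
    alpha pmu sTh mu_g finS SMK.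
  apply: (@sub_finite_set _ _ (_ `|` Z)); last by rewrite finite_setU; split; [exact: fin1|].
  move=> Q GQ; have [E|E] := eqVneq (mu (x Q - alpha)) 0; last by left.
  by right; apply/eqP; rewrite -subr_eq0 -(pth_linearB pmu) E.
have fibre nu i kappa := orbit_fibre_finite orb (mu := nu)
  (i := i) kappa.
have muTh i : mu Th`_i = 0.
  case: i => [|i]; first by rewrite (orbit_coef0 orb)// (pth_linear0 pmu).
  apply/eqP/negPn/negP => mui; apply: infZ; exact: (fibre mu i.+1).
have muThy y : mu Th.[y ^+ p] = 0.
  rewrite (pth_linear_horner pmu) (_ : map_poly _ _ = 0) ?horner0//.
  by apply/polyP => i; rewrite coef_map_id0 ?(pth_linear0 pmu)// coef0.
have mux Q c : mu (x (Q * 'X + c%:P)) = mu (th * x Q) + mu (x c%:P).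
  by rewrite (orbitMXaddC orb) !(pth_linearD pmu) muThy addr0.
(* Otherwise b |-> mu (th b) does not kill the leading coefficient of [Th], so its fibres along the
   orbit are finite, and by [mux] so is [Z]. *)
have /lam_ker[th' thE] : lam th = 0.
  apply/eqP/negPn/negP => lamth; apply: infZ.
  have pnu := pth_linear_mul pmu th.
  have nu_g : mu (th * Th`_(size Th).-1) != 0.
    by rewrite -lead_coefE /mu mulrCA mulVf ?mulr1.
  have i0 : (0 < (size Th).-1)%N by rewrite -subn1 subn_gt0.
  have fin c := fibre _ _ (mu alpha - mu (x c%:P)) pnu i0 nu_g.
  have finU : finite_set (\bigcup_(c in [set: F])
      [set Q | mu (th * x Q) = mu alpha - mu (x c%:P)]).
    by apply: bigcup_finite => // c _; exact: fin.
  apply: (orbit_finite orb (finite_image x finU)) => Q c E.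
  have {}E : mu (x (Q * 'X + c%:P)) = mu alpha by [].
  by exists Q => //; exists c => //; apply/eqP; rewrite -E mux addrK.
have iotaE c : iota c = (iota c ^+ m) ^+ p by rewrite -exprM mulnC; case: orb.
have muxth Q c : mu (x (Q * 'X + c%:P)) = th * mu (x Q) + iota c * mu (x 1).
  rewrite mux thE (pth_linearZ pmu) -[c%:P]mulr1 (orbitC orb).
  by rewrite iotaE (pth_linearZ pmu).
(* In [muxth], |th| > 1 and |iota c| is 0 or 1. So if [mu (x 1)] is nonzero, |mu (x Q)| >= |mu (x
   1)| for all nonzero Q; then Q |-> mu (x Q) is injective and [Z] has at most one point. *)
have mux1 : mu (x 1) = 0.
  apply/eqP/negPn/negP => mx1; apply: infZ.
  have iota_neq0 c : c != 0 -> iota c != 0.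
    apply: contra_neq => ic0; apply: (@polyC_inj F); apply: (orbit_inj orb).
    by rewrite -[c%:P]mulr1 (orbitC orb) ic0 mul0r polyC0 (orbit0 orb).
  have iota1 c : iota c != 0 -> v0 (iota c) = 1.
    move=> ic0; have pm2 : (p * m = (p * m).-2.+2)%N.
      by have := prime_gt1 p_prime; nia.
    have /(_ c) E : forall c, iota c ^+ (p * m) = iota c by case: orb.
    apply: (absval_root_of_unity av0 (n := (p * m).-2)); apply: (mulIf ic0).
    by rewrite mul1r -exprSr -pm2.
  have mux_ge Q : Q != 0 -> v0 (mu (x 1)) <= v0 (mu (x Q)).
    elim/poly_ind: Q => [|Q c IHQ]; first by rewrite eqxx.
    rewrite muxth; have [->|Q0] := eqVneq Q 0.
      rewrite mul0r add0r polyC_eq0 (orbit0 orb) (pth_linear0 pmu) mulr0 add0r => c0.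
      by rewrite (absvalM av0) iota1 ?mul1r ?iota_neq0.
    move=> _; have big : v0 (mu (x 1)) < v0 (th * mu (x Q)).
      have le_x1 := IHQ Q0; rewrite (le_lt_trans le_x1)// (absvalM av0) ltr_pMl//.
      by rewrite (lt_le_trans _ le_x1)// (absval_gt0 av0).
    have small : v0 (iota c * mu (x 1)) <= v0 (mu (x 1)).
      have [->|c0] := eqVneq (iota c) 0; first by rewrite mul0r (absval0 av0) (absval_ge0 av0).
      by rewrite (absvalM av0) iota1 ?mul1r.
    by rewrite (absvalDl_eq av0 na0) ?ltW// (le_lt_trans small).
  have Z1 P Q : Z P -> Z Q -> P = Q.
    move=> ZP ZQ; apply/eqP; rewrite -subr_eq0; apply/negPn/negP => /mux_ge.
    have -> : mu (x (P - Q)) = 0.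
      apply: (@addIr _ (mu (x Q))); rewrite -(pth_linearD pmu) -(orbitD orb) subrK add0r.
      by rewrite ZP ZQ.
    by rewrite (absval0 av0) leNgt (absval_gt0 av0) mx1.
  have [Z0|/set0P[Q0 ZQ0]] := eqVneq Z set0; first by rewrite Z0.
  by apply: (@sub_finite_set _ _ [set Q0]) => // Q ZQ; exact: Z1.
have mux0 Q : mu (x Q) = 0.
  elim/poly_ind: Q => [|Q c IHQ]; first by rewrite (orbit0 orb) (pth_linear0 pmu).
  by rewrite muxth IHQ mux1 !mulr0 addr0.
have mualpha : mu alpha = 0.
  apply/eqP/negPn/negP => mua; apply: infZ; rewrite (_ : Z = set0)// -subset0 => Q ZQ.
  have {}ZQ : mu (x Q) = mu alpha by [].
  by rewrite -ZQ mux0 eqxx in mua.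
(* The orbit, the coefficients of [Th] and [alpha] are now all of the form g times a p-th power;
   [xi], [h] and [alpha'] are the roots. *)
have [xi xiE] := choice (fun Q => mu_ker _ (mux0 Q)).
have [h hE] := choice (fun i => mu_ker _ (muTh i)).
have [alpha' alphaE] := mu_ker _ mualpha.
have [T [TMK finT T1]] := finite_bad_places hMK [:: g].
(* The factor [g ^+ i] comes from x(Q)^(p i) = g^(p i) xi(Q)^(p^2 i), whose p-th root is g^i
   xi(Q)^(p i). *)
pose Th' := \poly_(i < size Th) (h i * g ^+ i).
have xi_inj a b : g * a ^+ p = g * b ^+ p -> a = b.
  by move=> /(mulfI g0)/(expr_pchar_inj charK).
apply: infG.
(* [T] contains the places with |g| > 1; away from them u = g (xi(Q) - alpha')^p transfers the lower
   bound from u to xi(Q) - alpha'. *)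
apply: (@sub_finite_set _ _ [set Q | forall v, MK v -> ~ (S `|` T) v -> 1 <= v (xi Q - alpha')]).
  move=> Q GQ v Mv /not_orP[nSv nTv]; have av := place_absval hMK Mv.
  have := GQ v Mv nSv; rewrite xiE alphaE -mulrBr -exprB_pchar// (absvalM av) (absvalX av) => le1.
  have vg : v g <= 1 by apply: T1 => //; rewrite inE.
  rewrite -(ler_pXn2r p_gt0) ?nnegrE ?ler01 ?(absval_ge0 av)// expr1n (le_trans le1)//.
  by rewrite ler_piMl// exprn_ge0// (absval_ge0 av).
have th'1 : 1 < v0 th'.
  rewrite -(ltr_pXn2r p_gt0) ?nnegrE ?ler01 ?(absval_ge0 av0)//.
  by rewrite expr1n -(absvalX av0) -thE.
have th'0 : th' != 0 by rewrite -(absval_gt0 av0) (lt_trans ltr01).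
apply: (IH th' Th' (fun c => iota c ^+ m)).
- split.
  + by move=> P Q; apply: xi_inj; rewrite -xiE (orbitD orb) !xiE exprD_pchar// mulrDr.
  + by move=> P Q E; apply: (orbit_inj orb); rewrite !xiE E.
  + move=> Q; apply: xi_inj; rewrite -xiE (orbitMX orb) exprD_pchar// exprMn -thE xiE.
    rewrite mulrDr mulrCA; congr (_ + _).
    rewrite horner_coef (@horner_coef_wide _ (size Th) Th') ?size_poly//.
    rewrite expr_pchar_sum// mulr_sumr; apply: eq_bigr => i _.
    rewrite coef_poly ltn_ord hE -[in RHS]mulrA -(exprMn i) [X in _ = g * X]exprMn.
    by rewrite [in RHS]exprAC mulrA.
  + by move=> c Q; apply: xi_inj; rewrite -xiE (orbitC orb) xiE exprMn -iotaE mulrCA.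
  + by move=> c; rewrite -exprM mulnC exprM; case: orb => _ _ _ _ ->.
- rewrite (leq_trans sTh)// size_poly_eq// mulf_neq0//; last by rewrite expf_neq0.
  apply: contra_neq g0 => h0; rewrite /g lead_coefE hE h0 expr0n gtn_eqF// mulr0//.
- exact: th'1.
(* ln |th| is p times the positive integer ln |th'|, and p is at least 2. *)
- have lnE : ln (v0 th) = ln (v0 th') *+ p.
    by rewrite thE (absvalX av0) lnXn// (absval_gt0 av0).
  have /intrP[k kE] := place_ln_int hMK Mv0 th'0.
  have k0 : 0 < k by rewrite -(ltr0z R) -kE ln_gt0.
  move: thN; rewrite lnE kE -[_ *+ p]mulr_natr !pmulrn -intrM !ltr_int.
  by have := prime_gt1 p_prime; nia.
- by rewrite finite_setU.
- by move=> v [/SMK|/TMK].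
Qed.

End Core.

(** * Function fields *)

Lemma exists_lin_relation (L : fieldType) (I J : finType) (M : I -> J -> L) :
  (#|J| < #|I|)%N -> exists c : I -> L,
    (exists i, c i != 0) /\ forall j, \sum_i c i * M i j = 0.
Proof.
move=> JI; pose A := \matrix_(i < #|I|, j < #|J|) M (enum_val i) (enum_val j).
have : kermx A != 0.
  rewrite kermx_eq0 /row_free neq_ltn (leq_ltn_trans (rank_leq_col A)) ?orbT//.
case/rowV0Pn => u /sub_kermxP uA /rV0Pn[i ui].
exists (fun i => u 0 (enum_rank i)); split.
  by exists (enum_val i); rewrite enum_valK.
move=> j; have /matrixP/(_ 0 (enum_rank j)) := uA; rewrite !mxE => E.
rewrite -[RHS]E (reindex_onto (@enum_val I predT) enum_rank); last first.
  by move=> k _; rewrite enum_rankK.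
by apply: eq_big => [k|k _]; rewrite ?enum_valK ?eqxx// mxE enum_rankK.
Qed.

Lemma card_finField_pfactor (F : finFieldType) p : p \in GRing.pchar F ->
  exists m, #|F| = (p * m)%N.
Proof.
move=> charF; have := card_pprimeChar charF; rewrite /= => cF.
have F1 := finNzRing_gt1 F.
move: cF F1; case: (logn _ _) => [-> //|k cF _].
by exists (p ^ k)%N; rewrite -expnS -cF.
Qed.

(** Horner induction, with p = p' + 1: multiplication by X shifts the index, X^(p-1) X = X^p moves
    into the coefficient of index 0, and the new constant is a p-th power because F is finite. *)
Lemma poly_pth_decomposition (F : finFieldType) p' (f : {poly F}) :
    p'.+1 \in GRing.pchar F ->
  exists a : 'I_p'.+1 -> {poly F}, f = \sum_k a k ^+ p'.+1 * 'X^k.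
Proof.
move=> charF; have prime_p : prime p'.+1 by exact: pcharf_prime charF.
have pX : (GRing.pchar {poly F}).-nat p'.+1.
  by rewrite pnatE// pchar_poly.
elim/poly_ind: f => [|f c [a ->]].
  exists (fun=> 0); rewrite big1// => k _.
  by rewrite expr0n mul0r.
have [c' ->] : exists c', c = c' ^+ p'.+1.
  have [m cardF] := card_finField_pfactor charF.
  by exists (c ^+ m); rewrite -exprM mulnC -cardF expf_card.
exists (fun i => if unlift ord0 i is Some k then a (widen_ord (leqnSn _) k)
                 else a ord_max * 'X + c'%:P).
rewrite [RHS]big_ord_recl /= unlift_none [in LHS]big_ord_recr /= mulrDl expr0 mulr1.
rewrite exprDn_pchar// -rmorphXn exprMn [RHS]addrC addrA -[_ * 'X^p' * 'X]mulrA -exprSr.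
congr (_ + _ + _); rewrite mulr_suml; apply: eq_bigr => k _.
by rewrite liftK -mulrA -exprSr.
Qed.

Lemma divr_pth_decomposition (L : fieldType) p (n d : L) (a b : 'I_p.+1 -> L) :
    d != 0 -> n * d ^+ p = \sum_k a k ^+ p.+1 * b k ->
  n / d = \sum_k (a k / d) ^+ p.+1 * b k.
Proof.
move=> d0 E; apply: (mulIf (expf_neq0 p.+1 d0)).
rewrite exprS mulrA divfK// E mulr_suml; apply: eq_bigr => k _.
by rewrite -exprS expr_div_n [RHS]mulrAC divfK// expf_neq0.
Qed.

Lemma frac_pth_decomposition (F : finFieldType) p (l : {fraction {poly F}}) :
    p \in GRing.pchar F ->
  exists a : 'I_p -> {fraction {poly F}},
    l = \sum_k a k ^+ p * FracField.tofrac 'X ^+ k.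
Proof.
case: p => [|p'] charF; first by have := pcharf_prime charF.
rewrite (fracE l); set n := (frac _).1; set d := (frac _).2.
have d0 : FracField.tofrac d != 0 by rewrite tofrac_eq0 denom_ratioP.
(* n / d = n d^(p-1) / d^p, so only a polynomial has to be decomposed. *)
have [a aE] := poly_pth_decomposition (n * d ^+ p') charF.
exists (fun k => FracField.tofrac (a k) / FracField.tofrac d).
apply: divr_pth_decomposition => //.
rewrite -tofracXn -tofracM aE rmorph_sum; apply: eq_bigr => k _ /=.
by rewrite tofracM !tofracXn.
Qed.

Lemma frac_cancel (L : fieldType) (n d e : L) : d != 0 -> n * e = d * e * (n / d).
Proof. by move=> d0; field. Qed.

Section FunctionField.
Variables (F : finFieldType) (K : fieldExtType {fraction {poly F}}).

HB.instance Definition _ := GRing.RMorphism.copy (@embA F K)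
  (in_alg K \o @FracField.tofrac {poly F}).

Lemma embA_eq0 a : (embA K a == 0) = (a == 0).
Proof. by rewrite /embA scaler_eq0 oner_eq0 orbF tofrac_eq0. Qed.

Lemma embA_const_root_of_unity c : c != 0 -> embA K c%:P ^+ #|F|.-2.+1 = 1.
Proof.
move=> c0; have c0' : embA K c%:P != 0 by rewrite embA_eq0 polyC_eq0.
apply: (mulIf c0'); rewrite mul1r -exprSr.
rewrite (_ : #|F|.-2.+2 = #|F|); last by have := finNzRing_gt1 F; case: #|F| => [|[]].
by rewrite -!rmorphXn /= expf_card.
Qed.

Lemma pchar_funext p : p \in GRing.pchar F -> p \in GRing.pchar K.
Proof.
move=> pF; rewrite pchar_lalg.
by apply: (rmorph_pchar (@FracField.tofrac {poly F})); exact: (rmorph_pchar (@polyC F)).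
Qed.

(** This is [K : K^p] <= p. Seek a_i as a combination of a basis e_l of K over F(t), of dimension n,
    with coefficients c(i, l). Expanding e_l^p y_i in the elements t^k e_j over F(t)^p gives n p
    equations in n (p + 1) unknowns, linear after taking p-th roots. *)
Lemma pth_power_dependent p (y : 'I_p.+1 -> K) : p \in GRing.pchar F ->
  exists a : 'I_p.+1 -> K, (exists i, a i != 0) /\ \sum_i a i ^+ p * y i = 0.
Proof.
move=> charF; have charK := pchar_funext charF.
have pL : p \in GRing.pchar {fraction {poly F}}.
  by apply: (rmorph_pchar (@FracField.tofrac {poly F})); exact: (rmorph_pchar (@polyC F)).
pose n := \dim {:K}; pose e := vbasis {:K}.
pose T := FracField.tofrac ('X : {poly F}).
have decomp (z : K) : exists M : 'I_n * 'I_p -> {fraction {poly F}},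
    z = \sum_(j : 'I_n * 'I_p) (M j ^+ p * T ^+ j.2) *: e`_j.1.
  have [N NE] := choice (fun j : 'I_n => frac_pth_decomposition (coord e j z) charF).
  exists (fun j => N j.1 j.2); rewrite [LHS](coord_vbasis (memvf z)).
  rewrite -(pair_bigA _ (fun (i : 'I_n) (k : 'I_p) => (N i k ^+ p * T ^+ k) *: e`_i)) /=.
  by apply: eq_bigr => i _; rewrite -scaler_suml -NE.
have [M ME] := choice (fun il : 'I_p.+1 * 'I_n => decomp (e`_il.2 ^+ p * y il.1)).
have [|c [[[i l] cil] cM]] := exists_lin_relation M.
  by rewrite !card_prod !card_ord mulnC ltn_mul2r adim_gt0 /= ltnSn.
exists (fun i => \sum_l c (i, l) *: e`_l); split.
  exists i; apply: contraNneq cil => E.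
  by rewrite -(coord_sum_free (fun l => c (i, l)) l (basis_free (vbasisP _))) E linear0.
have aE i' : (\sum_l c (i', l) *: e`_l) ^+ p * y i' =
    \sum_l c (i', l) ^+ p *: (e`_l ^+ p * y i').
  rewrite (expr_pchar_sum charK) mulr_suml; apply: eq_bigr => k _.
  by rewrite exprZn scalerAl.
rewrite (eq_bigr _ (fun i _ => aE i)).
rewrite (pair_bigA _ (fun i l => c (i, l) ^+ p *: (e`_l ^+ p * y i))) /=.
under eq_bigr => il _ do rewrite -[il.2]/((il.1, il.2).2) -[il.1]/((il.1, il.2).1)
  -surjective_pairing ME scaler_sumr.
rewrite exchange_big big1// => j _.
under eq_bigr do rewrite scalerA mulrA -exprMn.
rewrite -scaler_suml -mulr_suml -(expr_pchar_sum pL) cM expr0n.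
by rewrite gtn_eqF ?mul0r ?scale0r// prime_gt0// (pcharf_prime charF).
Qed.

Lemma poly_dependent (I : finType) (y : I -> K) : (\dim {:K} < #|I|)%N ->
  exists a : I -> {poly F}, (exists i, a i != 0) /\ \sum_i embA K (a i) * y i = 0.
Proof.
move=> dimI; pose e := vbasis {:K}.
have [|c [[i ci] cE]] := exists_lin_relation (fun i (j : 'I_(\dim {:K})) => coord e j (y i)).
  by rewrite card_ord.
pose n i := (frac (repr (c i))).1; pose d i := (frac (repr (c i))).2.
have d0 i' : d i' != 0 by exact: denom_ratioP.
pose D := \prod_i d i.
exists (fun i => n i * \prod_(j | j != i) d j); split.
  exists i; rewrite mulf_neq0//; last by apply/prodf_neq0 => j _; exact: d0.
  apply: contra_neq ci => n0; rewrite (fracE (c i)) -/(n i) n0 tofrac0 mul0r//.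
have E i' : embA K (n i' * \prod_(j | j != i') d j) * y i' =
    FracField.tofrac D *: (c i' *: y i').
  rewrite scalerA /embA -scalerAl mul1r; congr (_ *: _).
  have -> : D = d i' * \prod_(j | j != i') d j by rewrite /D (bigD1 i').
  rewrite !tofracM [in RHS](fracE (c i')).
  apply: frac_cancel; rewrite tofrac_eq0; exact: d0.
transitivity (\sum_k FracField.tofrac D *: (c k *: y k)).
  by apply: eq_bigr => k _; exact: E.
rewrite -scaler_sumr [X in _ *: X](_ : _ = 0) ?scaler0//.
rewrite (eq_bigr (fun i => \sum_j (c i * coord e j (y i)) *: e`_j)); last first.
  move=> k _; rewrite [in LHS](coord_vbasis (memvf (y k))) scaler_sumr.
  by apply: eq_bigr => j _; rewrite scalerA.
rewrite exchange_big big1// => j _.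
by rewrite -scaler_suml cE scale0r.
Qed.

End FunctionField.

(** * Finiteness of points of bounded height *)

Section Northcott.
Variables (R : realType) (F : finFieldType) (K : fieldExtType {fraction {poly F}}).
Variable MK : set (K -> R).
Hypothesis hMK : is_normalized_places MK.
Variable v : K -> R.
Hypotheses (Mv : MK v) (vX : 1 < v (embA K 'X)).

Let av : is_absval v := place_absval hMK Mv.
Let na : nonarchimedean v := place_nonarch hMK Mv.
Let const (c : F) : K := embA K c%:P.

Lemma absval_const_le1 c : v (const c) <= 1.
Proof.
have [->|c0] := eqVneq c 0; first by rewrite /const polyC0 rmorph0 (absval0 av) ler01.
by rewrite (absval_root_of_unity av (embA_const_root_of_unity K c0)).
Qed.

Lemma absval_embA_lt (f : {poly F}) d : (size f <= d)%N ->
  v (embA K f) < v (embA K 'X) ^+ d.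
Proof.
move=> fd; have v0 : 0 < v (embA K 'X) by rewrite (lt_trans ltr01).
rewrite -[f]coefK poly_def rmorph_sum /=.
apply: (absval_sum_lt av na) => [|i _]; first by rewrite exprn_gt0.
rewrite -mul_polyC rmorphM rmorphXn /= (absvalM av) (absvalX av).
apply: (@le_lt_trans _ _ (v (embA K 'X) ^+ i)).
  by rewrite ler_piMl ?exprn_ge0 ?(ltW v0)//; exact: absval_const_le1.
by rewrite ltr_eXn2l// (leq_trans (ltn_ord i)).
Qed.

(** In a relation with polynomial coefficients of maximal degree d, isolate the coefficients of t^d.
    The rest of the sum is smaller than |t|^d rho, so the combination with the isolated constants is
    smaller than rho. *)
Lemma residue_dependent (I : finType) (y : I -> K) rho : 0 < rho ->
    (forall i, v (y i) <= rho) -> (\dim {:K} < #|I|)%N ->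
  exists c : I -> F, (exists i, c i != 0) /\ v (\sum_i const (c i) * y i) < rho.
Proof.
move=> rho0 y_rho dimI; have [a [[i ai] aE]] := poly_dependent y dimI.
pose k := [arg max_(j > i) size (a j)]%N.
have kmax j : (size (a j) <= size (a k))%N by rewrite /k; case: arg_maxnP => // l _; apply.
have ak0 : a k != 0.
  by rewrite -size_poly_gt0 (leq_trans _ (kmax i))// size_poly_gt0.
pose d := (size (a k)).-1.
have dE : size (a k) = d.+1 by rewrite prednK// size_poly_gt0.
exists (fun j => (a j)`_d); split; first by exists k; rewrite -lead_coefE lead_coef_eq0.
have vX0 : 0 < v (embA K 'X) by rewrite (lt_trans ltr01).
have vXd : 0 < v (embA K 'X) ^+ d by rewrite exprn_gt0.
rewrite -(ltr_pM2l vXd) -(absvalX av) -(absvalM av).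
have -> : embA K 'X ^+ d * (\sum_j const (a j)`_d * y j) =
    - \sum_j embA K (a j - (a j)`_d *: 'X^d) * y j.
  apply/eqP; rewrite -addr_eq0 mulr_sumr -big_split -[eqbRHS]aE; apply/eqP.
  apply: eq_bigr => j _ /=.
  by rewrite -mul_polyC rmorphB rmorphM rmorphXn /= -/(const _); ring.
rewrite (absvalN av); apply: (absval_sum_lt av na) => [|j _].
  by rewrite (absvalX av) mulr_gt0.
rewrite (absvalM av) (absvalX av); apply: (@lt_le_trans _ _ (v (embA K 'X) ^+ d * rho)) => //.
apply: (@le_lt_trans _ _ (v (embA K (a j - (a j)`_d *: 'X^d)) * rho)).
  by rewrite ler_wpM2l ?(absval_ge0 av).
rewrite ltr_pM2r// absval_embA_lt//; apply/leq_sizeP => l dl.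
rewrite coefB coefZ coefXn; have [->|ld] := eqVneq l d; first by rewrite mulr1 subrr.
rewrite mulr0 subr0 nth_default// (leq_trans (kmax j))// dE.
by rewrite ltn_neqAle eq_sym ld.
Qed.

(** The closed ball of radius rho modulo the open one is an F-vector space of dimension at most
    [K : F(t)] by [residue_dependent], hence finite. A maximal independent family yields the
    representatives. *)
Lemma residue_cover rho : 0 < rho -> exists2 A : set K, finite_set A &
  forall y, v y <= rho -> exists2 r, A r & v (y - r) < rho.
Proof.
move=> rho0.
pose P m := `[< exists2 y : 'I_m -> K, forall i, v (y i) <= rho &
  forall c : 'I_m -> F, v (\sum_i const (c i) * y i) < rho -> forall i, c i = 0 >].
have P0 : exists m, P m.
  exists 0%N; apply/asboolP; exists (fun=> 0) => [[]//|c _ []//].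
have Pmax m : P m -> (m <= \dim {:K})%N.
  move=> /asboolP[y y_rho yc]; rewrite leqNgt; apply/negP => dim_m.
  have [|c [[i ci] /yc c0]] := residue_dependent rho0 y_rho.
    by rewrite card_ord.
  by rewrite c0 eqxx in ci.
case: (ex_maxnP P0 Pmax) => m /asboolP[y y_rho yc] mmax.
exists ((fun c : {ffun 'I_m -> F} => \sum_i const (c i) * y i) @` setT).
  by apply: finite_image; exact: finite_finset.
move=> z z_rho; apply: contrapT => nz.
suff /mmax : P m.+1 by rewrite ltnn.
apply/asboolP; exists (fun i => if unlift ord0 i is Some j then y j else z).
  by move=> i; case: unliftP => [j|] _.
move=> c; rewrite big_ord_recl unlift_none.
under eq_bigr do rewrite liftK.
have [c0|c0] := eqVneq (c ord0) 0.
  rewrite c0 /const polyC0 rmorph0 mul0r add0r => /yc cE i.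
  by case: (unliftP ord0 i) => [j ->|->].
move=> lt_rho; exfalso; apply: nz.
have c0' : const (c ord0) != 0 by rewrite embA_eq0 polyC_eq0.
exists (\sum_i const (- (c (lift ord0 i) / c ord0)) * y i).
  by exists [ffun i => - (c (lift ord0 i) / c ord0)] => //; apply: eq_bigr => i _; rewrite ffunE.
have -> : z - \sum_i const (- (c (lift ord0 i) / c ord0)) * y i =
    const (c ord0)^-1 * (const (c ord0) * z + \sum_i const (c (lift ord0 i)) * y i).
  rewrite mulrDr mulrA -rmorphM -polyCM mulVf// polyC1 rmorph1 mul1r; congr (_ + _).
  rewrite -sumrN mulr_sumr; apply: eq_bigr => i _.
  by rewrite [_ / c ord0]mulrC /const polyCN rmorphN mulNr opprK polyCM rmorphM mulrA.
rewrite (absvalM av) (le_lt_trans _ lt_rho)// ler_piMl ?(absval_ge0 av)//.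
exact: absval_const_le1.
Qed.

(** Logarithms of absolute values are integers, so each use of [residue_cover] shrinks the radius by
    a factor e. *)
Lemma residue_cover_iter (k : int) m : exists2 A : set K, finite_set A &
  forall y, v y <= expR k%:~R -> exists2 r, A r & v (y - r) <= expR (k - m%:Z)%:~R.
Proof.
elim: m => [|m [A finA AP]].
  by exists [set 0] => // y yk; exists 0 => //; rewrite !subr0.
have [B finB BP] := residue_cover (expR_gt0 ((k - m%:Z)%:~R : R)).
exists [set a + b | a in A & b in B]; first exact: finite_image2.
move=> y /AP[a Aa /BP[b Bb yab]]; exists (a + b); first by exists a => //; exists b.
rewrite opprD addrA; set z := y - a - b in yab *.
have [->|z0] := eqVneq z 0; first by rewrite (absval0 av) expR_ge0.
have vz : 0 < v z by rewrite (absval_gt0 av).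
have /intrP[l lE] := place_ln_int hMK Mv z0.
move: yab; rewrite -[v z]lnK ?posrE// lE ltr_expR ler_expR ltr_int ler_int.
lia.
Qed.

(** By the product formula two distinct points of the set are at least 1/D apart at [v], while
    finitely many balls of a smaller radius cover the set. *)
Lemma northcott (T : set (K -> R)) (B : (K -> R) -> R) :
  T `<=` MK -> finite_set T ->
  finite_set [set y | (forall w, MK w -> ~ T w -> w y <= 1) /\
                      (forall w, T w -> w y <= B w)].
Proof.
move=> TMK finT; set Y := [set y | _].
pose b w := if w \in T then Num.max 1 (B w) else 1.
pose T' := T `|` [set v].
have T'MK : T' `<=` MK by move=> w [/TMK|->].
have finT' : finite_set T' by rewrite finite_setU.
pose D := \prod_(w <- fset_set T') b w.
have b1 w : 1 <= b w by rewrite /b; case: ifP => // _; rewrite le_max lexx.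
have Yb y w : Y y -> MK w -> w y <= b w.
  move=> [Y1 YB] Mw; rewrite /b; case: ifPn => [|]; last by rewrite notin_setE; exact: Y1.
  by rewrite inE => Tw; rewrite le_max YB ?orbT.
have sep y y' : Y y -> Y y' -> D * v (y - y') < 1 -> y = y'.
  move=> Yy Yy'; apply: contraPeq; rewrite -subr_eq0 => z0; apply/negP; rewrite -leNgt.
  have zb w : MK w -> w (y - y') <= b w.
    move=> Mw; apply: (absvalB_le (place_absval hMK Mw) (place_nonarch hMK Mw)); exact: Yb.
  apply: le_trans (b1 v) _; apply: (prod_places_lower hMK T'MK finT' z0) => [w Mw nTw|w /T'MK|].
  - by have := zb w Mw; rewrite /b memNset// => Tw; apply: nTw; left.
  - exact: zb.
  - by right.
have D0 : 0 < D by rewrite (lt_le_trans ltr01)// prodr_ge1.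
have [k bk] : exists k : int, b v <= expR k%:~R.
  exists (Num.ceil (ln (b v))); rewrite -[leLHS]lnK ?posrE ?(lt_le_trans ltr01)//.
  by rewrite ler_expR ceil_ge.
have [m Dm] : exists m : nat, D * expR (k - m%:Z)%:~R < 1.
  exists (`|Num.ceil (ln D)| + `|k| + 1)%N.
  rewrite -{1}[D]lnK ?posrE// -expRD -[ltRHS]expR0 ltr_expR.
  have := ceil_ge (ln D); set c := Num.ceil _ => Dc.
  apply: (le_lt_trans (lerD Dc (lexx _))); rewrite -intrD ltrz0.
  lia.
have [A finA AP] := residue_cover_iter k m.
have : Y `<=` \bigcup_(r in A) [set y | Y y /\ v (y - r) <= expR (k - m%:Z)%:~R].
  move=> y Yy; have [|r Ar yr] := AP y; last by exists r.
  exact: le_trans (Yb y v Yy Mv) bk.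
move=> /sub_finite_set; apply; apply: bigcup_finite => // r Ar.
set Z := [set y | _]; have [->|/set0P[y0 [Yy0 y0r]]] := eqVneq Z set0; first by [].
apply: (@sub_finite_set _ _ [set y0]) => // y [Yy yr]; apply: sep => //.
apply: le_lt_trans Dm; rewrite ler_wpM2l ?(ltW D0)//.
rewrite (_ : y - y0 = (y - r) - (y0 - r)); last by rewrite opprB addrA subrK.
exact: (absvalB_le av na yr y0r).
Qed.

End Northcott.

(** * A place above infinity *)

Definition is_subring (K : fieldType) (O : set K) : Prop :=
  [/\ O 1, forall x y, O x -> O y -> O (x - y) & forall x y, O x -> O y -> O (x * y)].

Section Subring.
Variables (K : fieldType) (O : set K).
Hypothesis ringO : is_subring O.

Lemma subring1 : O 1. Proof. by case: ringO. Qed.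

Lemma subringB x y : O x -> O y -> O (x - y). Proof. by case: ringO => _ + _; apply. Qed.

Lemma subringM x y : O x -> O y -> O (x * y). Proof. by case: ringO => _ _; apply. Qed.

Lemma subring0 : O 0. Proof. by rewrite -(subrr 1); apply: subringB; exact: subring1. Qed.

Lemma subringN x : O x -> O (- x).
Proof. by move=> Ox; rewrite -sub0r; apply: subringB => //; exact: subring0. Qed.

Lemma subringD x y : O x -> O y -> O (x + y).
Proof. by move=> Ox Oy; rewrite -[y]opprK; apply: subringB => //; exact: subringN. Qed.

Lemma subringX x n : O x -> O (x ^+ n).
Proof.
move=> Ox; elim: n => [|n IHn]; first exact: subring1.
by rewrite exprS; apply: subringM.
Qed.

Lemma subring_sum (I : Type) (s : seq I) (P : pred I) (f : I -> K) :
  (forall i, P i -> O (f i)) -> O (\sum_(i <- s | P i) f i).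
Proof. by move=> Of; apply: big_ind => //; [exact: subring0 | exact: subringD]. Qed.

Definition adjoin (x : K) : set K :=
  [set y | exists2 p : {poly K}, forall i, O p`_i & y = p.[x]].

Lemma sub_adjoin x : O `<=` adjoin x.
Proof.
move=> y Oy; exists y%:P; last by rewrite hornerC.
by move=> i; rewrite coefC; case: ifP => // _; exact: subring0.
Qed.

Lemma adjoin_gen x : adjoin x x.
Proof.
exists 'X; last by rewrite hornerX.
by move=> i; rewrite coefX; case: eqP => _; [exact: subring1 | exact: subring0].
Qed.

Lemma is_subring_adjoin x : is_subring (adjoin x).
Proof.
split=> [|_ _ [p Op ->] [q Oq ->]|_ _ [p Op ->] [q Oq ->]].
- by apply: sub_adjoin; exact: subring1.
- by exists (p - q) => [i|]; rewrite ?hornerE// coefB; apply: subringB.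
- exists (p * q) => [i|]; rewrite ?hornerM// coefM.
  by apply: subring_sum => j _; exact: subringM.
Qed.

End Subring.

(** * Chevalley's construction of a valuation ring *)

Section MaximalSubring.
Variables (K : fieldType) (t : K).
Hypothesis t0 : t != 0.

(** A maximal such ring is a valuation ring whose maximal ideal contains t^-1, so it lies above
    infinity. *)
Definition subring_avoiding (O : set K) : Prop := [/\ is_subring O, O t^-1 & ~ O t].

Lemma exists_maximal_subring (B : set K) : subring_avoiding B ->
  exists2 O, subring_avoiding O &
             forall O', subring_avoiding O' -> O `<=` O' -> O' `<=` O.
Proof.
move=> avB; pose P (X : set K) := X = set0 \/ subring_avoiding X.
have [C CP Ctot|O [PO maxO]] := @Zorn_bigcup K P.
  have [C0|/existsNP[X0 /not_implyP[CX0 /eqP/set0P[x0 X0x0]]]] := pselect (forall X, C X -> X = set0).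
    left; rewrite -subset0 => x [X /C0 ->]//.
  right; have av X x : C X -> X x -> subring_avoiding X.
    by move=> /CP[-> //|].
  have avX0 := av _ _ CX0 X0x0.
  have common x y : (\bigcup_(X in C) X) x -> (\bigcup_(X in C) X) y ->
        exists2 X, C X & X x /\ X y.
    move=> [X CX Xx] [Y CY Yy]; have [XY|YX] := Ctot _ _ CX CY.
      by exists Y => //; split=> //; exact: XY.
    by exists X => //; split=> //; exact: YX.
  split=> [|| [X CX Xt]]; last by case: (av _ _ CX Xt).
    split=> [|x y /common /[apply] -[X CX [Xx Xy]]|x y /common /[apply] -[X CX [Xx Xy]]].
    - by exists X0 => //; case: avX0 => -[].
    - by exists X => //; case: (av _ _ CX Xx) => -[_ + _ _ _]; apply.
    - by exists X => //; case: (av _ _ CX Xx) => -[_ _ + _ _]; apply.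
  by exists X0 => //; case: avX0.
have avO : subring_avoiding O.
  case: PO => // O0; exfalso; apply: (maxO B); last by right.
  rewrite O0; split; first exact: sub0set.
  by move=> /(_ 1); apply; case: avB => -[].
exists O => // O' avO' OO'; apply: contrapT => nO'O.
by apply: (maxO O'); [split|right].
Qed.

Variable O : set K.
Hypotheses (avO : subring_avoiding O)
  (maxO : forall O', subring_avoiding O' -> O `<=` O' -> O' `<=` O).

Let ringO : is_subring O. Proof. by case: avO. Qed.
Let Ot1 : O t^-1. Proof. by case: avO. Qed.
Let nOt : ~ O t. Proof. by case: avO. Qed.

Lemma adjoin_maximal x : ~ O x -> adjoin O x t.
Proof.
move=> nOx; apply: contrapT => nt; apply: nOx.
apply: (maxO (O' := adjoin O x)); last exact: adjoin_gen.
  split=> //; first exact: is_subring_adjoin.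
  exact: sub_adjoin.
exact: sub_adjoin.
Qed.

(** Otherwise t is a polynomial over [O] in u^-1, where u = 1 - t^-1 a, so t u^n is in [O] for some
    n. But u^n is 1 modulo t^-1 O, so t u^n differs from t by an element of [O], and t would be in
    [O]. *)
Lemma maximal_subring_unit a : O a -> O (1 - t^-1 * a)^-1.
Proof.
move=> Oa; set u := 1 - _; have Ou : O u.
  by apply: (subringB ringO); [exact: subring1 | exact: subringM].
apply: contrapT => /adjoin_maximal[p Op tE].
have u0 : u != 0.
  apply/negP; rewrite subr_eq0 => /eqP E; apply: nOt.
  by rewrite -[t]mulr1 E mulrA divff// mul1r.
have [b Ob uE] : exists2 b, O b & u ^+ (size p) = 1 - t^-1 * b.
  elim: (size p) => [|n [b Ob uE]].
    by exists 0; [exact: subring0|rewrite mulr0 subr0].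
  exists (a + b - t^-1 * a * b).
    apply: (subringB ringO); first exact: subringD.
    by apply: subringM => //; exact: subringM.
  by rewrite exprS uE /u; ring.
have : O (t * u ^+ size p).
  rewrite {1}tE horner_coef mulr_suml; apply: (subring_sum ringO) => i _.
  rewrite -mulrA; apply: (subringM ringO) => //.
  rewrite exprVn mulrC -[X in _ ^+ X](subnK (ltnW (ltn_ord i))) exprD mulfK ?expf_neq0//.
  exact: subringX.
rewrite uE mulrBr mulr1 mulrA divff// mul1r => Otb; apply: nOt.
by rewrite -(subrK b t); exact: subringD.
Qed.

(* The top coefficient is eliminated with the relation of lower degree for the inverse. *)
Lemma maximal_subring_reduce x n m (p q : {poly K}) : x != 0 -> (m <= n)%N ->
    (forall i, O p`_i) -> (size p <= n.+1)%N -> p.[x] = t ->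
    (forall i, O q`_i) -> (size q <= m.+1)%N -> q.[x^-1] = t ->
  exists2 p' : {poly K}, forall i, O p'`_i & (size p' <= n)%N /\ p'.[x] = t.
Proof.
move=> x0 mn Op sp pE Oq sq qE.
pose u := 1 - t^-1 * q`_0; have Ou := maximal_subring_unit (Oq 0%N).
have u0 : u != 0.
  apply/negP; rewrite subr_eq0 => /eqP E; apply: nOt.
  by rewrite -[t]mulr1 E mulrA divff// mul1r.
pose r := \poly_(i < m) q`_(m - i).
have rE : u * x ^+ m = t^-1 * r.[x].
  have : x ^+ m * q.[x^-1] = q`_0 * x ^+ m + r.[x].
    rewrite (@horner_coef_wide _ m.+1 q)// big_ord_recl expr0 mulr1 mulrDr [x ^+ m * _]mulrC.
    congr (_ + _); rewrite (@horner_coef_wide _ m r) ?size_poly// mulr_sumr.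
    rewrite [RHS](reindex_inj rev_ord_inj); apply: eq_bigr => i _ /=.
    rewrite coef_poly ltn_subrL (leq_ltn_trans _ (ltn_ord i))// subKn// mulrCA.
    congr (_ * _); rewrite exprVn -[X in x ^+ X * _](subnK (ltn_ord i)) exprD mulfK//.
    by rewrite expf_neq0.
  rewrite qE => E; apply: (mulfI t0); rewrite mulrA [t * u]mulrBr mulr1 !mulrA divff// !mul1r.
  by rewrite mulrBl [t * _]mulrC E addrC addKr.
exists ((\poly_(i < n) p`_i) + (p`_n * (u^-1 * t^-1)) *: ('X^(n - m) * r)).
  move=> i; rewrite coefD coefZ coefXnM coef_poly; apply: (subringD ringO).
    by case: ifP => // _; exact: subring0.
  apply: (subringM ringO); first by apply: subringM => //; exact: subringM.
  rewrite coef_poly; case: ifP => _; first exact: subring0.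
  by case: ifP => _ //; exact: subring0.
split.
  rewrite (leq_trans (size_polyD _ _))// geq_max size_poly/=.
  rewrite (leq_trans (size_scale_leq _ _))// (leq_trans (size_polyMleq _ _))//.
  by rewrite size_polyXn /= -{2}(subnK mn) leq_add2l size_poly.
rewrite hornerD hornerZ hornerM hornerXn -{2}pE (@horner_coef_wide _ n.+1 p)// big_ord_recr /=.
congr (_ + _).
  by rewrite (@horner_coef_wide _ n) ?size_poly//; apply: eq_bigr => i _; rewrite coef_poly ltn_ord.
have -> : x ^+ n = u^-1 * (x ^+ (n - m) * (u * x ^+ m)).
  by rewrite mulrCA mulKf// -exprD subnK.
by rewrite rE; ring.
Qed.

(** If neither x nor x^-1 is in [O], maximality writes t as a polynomial over [O] in each of them.
    With both degrees minimal, [maximal_subring_reduce] lowers the larger one. *)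
Lemma maximal_subring_valuation x : O x \/ O x^-1.
Proof.
have [->|x0] := eqVneq x 0; first by left; exact: (subring0 ringO).
apply: contrapT => /not_orP[nOx nOx1].
pose P z n := `[< exists2 p : {poly K}, forall i, O p`_i & (size p <= n.+1)%N /\ p.[z] = t >].
have exP z : ~ O z -> exists n, P z n.
  move=> /adjoin_maximal[p Op tE]; exists (size p); apply/asboolP.
  by exists p => //; split=> //; exact: leqnSn.
case: (ex_minnP (exP _ nOx)) => n /asboolP[p Op [sp pE]] minn.
case: (ex_minnP (exP _ nOx1)) => m /asboolP[q Oq [sq qE]] minm.
have no_drop z k (r : {poly K}) : (forall i, O r`_i) -> (size r <= k)%N -> r.[z] = t ->
    (forall l, P z l -> (k <= l)%N) -> False.
  case: k => [|k] Or sr rE mink.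
    move: rE; rewrite (_ : r = 0) ?horner0; last by apply/eqP; rewrite -size_poly_eq0 -leqn0.
    by move=> rE; move: t0; rewrite -rE eqxx.
  by have /mink : P z k; [apply/asboolP; exists r | rewrite ltnn].
have [mn|nm] := leqP m n.
  have [p' Op' [sp' pE']] := maximal_subring_reduce x0 mn Op sp pE Oq sq qE.
  exact: (no_drop x n p').
have x10 : x^-1 != 0 by rewrite invr_eq0.
have [|q' Oq' [sq' qE']] := maximal_subring_reduce x10 (ltnW nm) Oq sq qE Op sp.
  by rewrite invrK.
exact: (no_drop x^-1 m q').
Qed.

End MaximalSubring.

Lemma divr_cancel_both (L : fieldType) (A B f : L) :
  A != 0 -> B != 0 -> f != 0 -> f^-1 = A * (A * B * f)^-1 * B.
Proof. by move=> A0 B0 f0; field; rewrite ?A0 ?B0 ?f0. Qed.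

(** Bookkeeping for dividing a relation of degree k for x by y^(k-1): the powers of u, which will be
    t^-1, are shared between y and the coefficient B. *)
Lemma integral_relation_term (L : fieldType) (x u y A B : L) (a k i : nat) :
    y = x * u ^+ a -> y != 0 -> (i < k)%N ->
  A * B * x ^+ i * (u ^+ a) ^+ k =
  y ^+ k.-1 * (A * (B * u ^+ (a * (k - i))) * y^-1 ^+ (k - i).-1).
Proof.
move=> yE y0 ik.
have -> : y ^+ k.-1 = y ^+ i * y ^+ (k - i).-1 by rewrite -exprD; congr (_ ^+ _); lia.
have -> : (u ^+ a) ^+ k = u ^+ (a * i) * u ^+ (a * (k - i)).
  by rewrite -exprD -mulnDr subnKC ?exprM// ltnW.
have yy : y ^+ (k - i).-1 * y^-1 ^+ (k - i).-1 = 1 by rewrite -exprMn divff// expr1n.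
have -> : y ^+ i = x ^+ i * u ^+ (a * i) by rewrite yE exprMn -exprM.
rewrite -[LHS]mulr1 -yy; move: (y ^+ _) (y^-1 ^+ _) (u ^+ (a * (k - i))) (u ^+ (a * i)) (x ^+ i).
by move=> *; ring.
Qed.

(** * From the valuation ring to a real absolute value *)

Section Gauge.
Variables (R : realType) (K : fieldType) (t : K) (O : set K).
Hypotheses (t0 : t != 0) (avO : subring_avoiding t O).
Hypothesis valO : forall x, O x \/ O x^-1.
Hypothesis archO : forall x, x != 0 -> exists a : nat, O (x * t^-1 ^+ a).

Let ringO : is_subring O. Proof. by case: avO. Qed.
Let Ot1 : O t^-1. Proof. by case: avO. Qed.
Let nOt : ~ O t. Proof. by case: avO. Qed.

Lemma subring_exprz_ge0 a : O (t ^ (- a)) -> 0 <= a.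
Proof.
case: a => // n; rewrite NegzE opprK => Otn; exfalso; apply: nOt.
have -> : t = t ^+ n.+1 * t^-1 ^+ n by rewrite exprS exprVn mulfK// expf_neq0.
by apply: (subringM ringO) => //; exact: subringX.
Qed.

(* Upper cut of the rationals a / b with x ^ b in t ^ a O. *)
Definition gauge_cut (x : K) : set R :=
  [set r | exists a : int, exists b : nat,
    r = a%:~R / b.+1%:R /\ O (x ^+ b.+1 * t ^ (- a))].

Lemma gauge_cutM x y r s : gauge_cut x r -> gauge_cut y s -> gauge_cut (x * y) (r + s).
Proof.
move=> [a [b [-> Ox]]] [a' [b' [-> Oy]]].
exists (a * b'.+1%:Z + a' * b.+1%:Z), (b.+1 * b'.+1).-1; rewrite prednK ?muln_gt0//; split.
  by rewrite addf_div ?pnatr_eq0// natrM intrD !intrM.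
have -> : (x * y) ^+ (b.+1 * b'.+1) * t ^ (- (a * b'.+1%:Z + a' * b.+1%:Z)) =
    (x ^+ b.+1 * t ^ (- a)) ^+ b'.+1 * (y ^+ b'.+1 * t ^ (- a')) ^+ b.+1.
  have tE c n : t ^ (- (c * n%:Z)) = (t ^ (- c)) ^+ n by rewrite exprnP exprz_exp mulNr.
  rewrite opprD expfzDr// !tE [in RHS]exprMn [X in _ = _ * X]exprMn [RHS]mulrACA.
  by rewrite exprMn -!exprM; congr (_ * _ ^+ _ * _); rewrite mulnC.
by apply: (subringM ringO); apply: (subringX ringO).
Qed.

Lemma gauge_cut1 r : gauge_cut 1 r -> 0 <= r.
Proof.
by move=> [a [b [-> ]]]; rewrite expr1n mul1r => /subring_exprz_ge0 a0; rewrite divr_ge0 ?ler0z.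
Qed.

Lemma gauge_cut_add_ge0 x r s : x != 0 -> gauge_cut x r -> gauge_cut x^-1 s -> 0 <= r + s.
Proof. by move=> x0 xr xs; apply: gauge_cut1; rewrite -(divff x0); exact: gauge_cutM. Qed.

Lemma gauge_cut_nonempty x : x != 0 -> gauge_cut x !=set0.
Proof.
move=> /archO[a Oa]; exists a%:R; exists a%:Z, 0%N; rewrite divr1; split=> //.
by rewrite expr1 -exprz_inv.
Qed.

Lemma gauge_cut_lbound x : x != 0 -> has_lbound (gauge_cut x).
Proof.
move=> x0; have x10 : x^-1 != 0 by rewrite invr_eq0.
have [s xs] := gauge_cut_nonempty x10; exists (- s) => r xr.
by rewrite -subr_ge0 opprK; exact: (gauge_cut_add_ge0 x0).
Qed.

Definition gauge (x : K) : R := inf (gauge_cut x).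

Lemma gauge_le x r : x != 0 -> gauge_cut x r -> gauge x <= r.
Proof. by move=> x0; apply: ge_inf; exact: gauge_cut_lbound. Qed.

Lemma gauge_ge x c : x != 0 -> (forall r, gauge_cut x r -> c <= r) -> c <= gauge x.
Proof. by move=> x0 xc; apply: lb_le_inf; [exact: gauge_cut_nonempty | exact: xc]. Qed.

Lemma gaugeM_le x y : x != 0 -> y != 0 -> gauge (x * y) <= gauge x + gauge y.
Proof.
move=> x0 y0; rewrite -lerBlDr; apply: gauge_ge => // r xr.
rewrite lerBlDr addrC -lerBlDr; apply: gauge_ge => // s ys; rewrite lerBlDr addrC.
by apply: gauge_le; [rewrite mulf_neq0 | exact: gauge_cutM].
Qed.

(** No rational a / b lies strictly between [- gauge x^-1] and [gauge x]: the valuation property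
    puts x^b t^(-a) or its inverse in [O], so a / b bounds [gauge x] from above or -a / b bounds
    [gauge x^-1]. *)
Lemma gaugeV x : x != 0 -> gauge x^-1 = - gauge x.
Proof.
move=> x0; have x10 : x^-1 != 0 by rewrite invr_eq0.
apply/eqP; rewrite eq_le; apply/andP; split; last first.
  apply: gauge_ge => // s xs; rewrite lerNl; apply: gauge_ge => // r xr.
  by rewrite -subr_ge0 opprK; exact: (gauge_cut_add_ge0 x0).
rewrite leNgt; apply/negP => lt_x; have {}lt_x : - gauge x^-1 < gauge x by rewrite ltrNl.
have [q] := rat_in_itvoo lt_x; rewrite in_itv /= => /andP[q1 q2].
have [b qb] := denqP q.
have qE : ratr q = (numq q)%:~R / b.+1%:R :> R by rewrite /ratr qb.
have [Oq|Oq] := valO (x ^+ b.+1 * t ^ (- numq q)).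
  have : gauge x <= ratr q by apply: gauge_le => //; rewrite qE; exists (numq q), b.
  by rewrite leNgt q2.
have : gauge x^-1 <= - ratr q.
  apply: gauge_le => //; rewrite qE; exists (- numq q), b; rewrite intrN mulNr; split=> //.
  by rewrite exprVn -invr_expz -invfM.
by rewrite leNgt ltrNl q1.
Qed.

Lemma gaugeM x y : x != 0 -> y != 0 -> gauge (x * y) = gauge x + gauge y.
Proof.
move=> x0 y0; apply/eqP; rewrite eq_le gaugeM_le//= -lerBrDr -gaugeV//.
by rewrite -{1}[x](mulfK y0) gaugeM_le// ?mulf_neq0// invr_eq0.
Qed.

Lemma gauge_subring z : O z -> z != 0 -> gauge z <= 0.
Proof.
move=> Oz z0; apply: gauge_le => //; exists 0, 0%N; rewrite mul0r; split=> //.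
by rewrite oppr0 expr0z mulr1.
Qed.

Lemma gaugeD x y : x != 0 -> y != 0 -> x + y != 0 ->
  gauge (x + y) <= Num.max (gauge x) (gauge y).
Proof.
have wlogxy x' y' : x' != 0 -> y' != 0 -> x' + y' != 0 -> O (x' / y') ->
    gauge (x' + y') <= gauge y'.
  move=> x0 y0 xy0 Oxy.
  have E : x' + y' = (x' / y' + 1) * y' by rewrite mulrDl divfK// mul1r.
  have z0 : x' / y' + 1 != 0 by apply: contraNneq xy0 => z0; rewrite E z0 mul0r.
  rewrite E gaugeM// gerDr gauge_subring//.
  by apply: (subringD ringO) => //; exact: subring1.
move=> x0 y0 xy0; have [Oxy|] := valO (x / y); first by rewrite le_max wlogxy ?orbT.
by rewrite invf_div => Oyx; rewrite le_max addrC wlogxy// addrC.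
Qed.

Definition gauge_absval (x : K) : R := if x == 0 then 0 else expR (gauge x).

Lemma gauge_absval_gt1 : 1 < gauge_absval t.
Proof.
rewrite /gauge_absval (negPf t0) expR_gt1 -oppr_lt0 -gaugeV//.
apply: (@le_lt_trans _ _ (-1)); last by rewrite oppr_lt0.
apply: gauge_le; first by rewrite invr_eq0.
exists (-1), 0%N; rewrite divr1 intrN; split=> //.
by rewrite opprK expr1 expr1z mulVf//; exact: subring1.
Qed.

Lemma gauge_absval_ultrametric : nonarchimedean gauge_absval.
Proof.
move=> x y; rewrite /gauge_absval.
have [->|x0] := eqVneq x 0; first by rewrite add0r le_max lexx orbT.
have [->|y0] := eqVneq y 0; first by rewrite addr0 (negPf x0) le_max lexx.
have [_|xy0] := eqVneq (x + y) 0; first by rewrite le_max expR_ge0.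
have := gaugeD x0 y0 xy0; rewrite !le_max => /orP[H|H]; apply/orP; [left|right];
by rewrite ler_expR.
Qed.

Lemma is_absval_gauge : is_absval gauge_absval.
Proof.
have ge0 x : 0 <= gauge_absval x by rewrite /gauge_absval; case: ifP => // _; exact: expR_ge0.
split=> // [x|x y|x y].
- rewrite /gauge_absval; split=> [|->]; last by rewrite eqxx.
  by case: eqP => // _ /eqP; rewrite gt_eqF ?expR_gt0.
- rewrite /gauge_absval mulf_eq0; have [->|x0] := eqVneq x 0; first by rewrite /= mul0r.
  have [->|y0] := eqVneq y 0; first by rewrite /= mulr0.
  by rewrite gaugeM// expRD.
- apply: (le_trans (gauge_absval_ultrametric x y)).
  by rewrite ge_max lerDl lerDr !ge0.
Qed.

End Gauge.

(** * Valuation rings of K above infinity *)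

Section PlaceAtInfinity.
Variables (F : finFieldType) (K : fieldExtType {fraction {poly F}}).

Let t : K := embA K 'X.

Lemma embA_X_neq0 : t != 0. Proof. by rewrite embA_eq0 polyX_eq0. Qed.

(** The ring is F[t^-1], seen as the fractions f / t^n with deg f <= n; comparing degrees excludes
    t. *)
Lemma subring_avoiding_embAX : exists B, subring_avoiding t B.
Proof.
pose B : set K := [set y | exists n : nat, exists f : {poly F},
  (size f <= n.+1)%N /\ y * t ^+ n = embA K f].
have t0 := embA_X_neq0.
have size_MX (f : {poly F}) n m : (size f <= n.+1)%N -> (size (f * 'X^m)%R <= (n + m).+1)%N.
  move=> sf; rewrite (leq_trans (size_polyMleq _ _))// size_polyXn addnS /=.
  by rewrite -addSn leq_add2r.
exists B; split.
- split.
  + by exists 0%N, 1; rewrite size_poly1 mulr1 rmorph1.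
  + move=> x y [n [f [sf xE]]] [m [g [sg yE]]]; exists (n + m)%N, (f * 'X^m - g * 'X^n).
    split.
      rewrite (leq_trans (size_polyD _ _))// geq_max size_polyN size_MX//=.
      by rewrite addnC size_MX.
    by rewrite rmorphB !rmorphM !rmorphXn /= -xE -yE exprD -/t; ring.
  + move=> x y [n [f [sf xE]]] [m [g [sg yE]]]; exists (n + m)%N, (f * g); split.
      rewrite (leq_trans (size_polyMleq _ _))//.
      by have := leq_add sf sg; lia.
    by rewrite rmorphM /= -xE -yE exprD; ring.
- by exists 1%N, 1; rewrite size_poly1 mulVf// rmorph1.
- move=> [n [f [sf]]]; rewrite -exprS => fE.
  have {}fE : 'X^(n.+1) = f.
    by apply/eqP; rewrite -subr_eq0 -(embA_eq0 K) rmorphB rmorphXn /= -/t fE subrr.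
  by move: sf; rewrite -fE size_polyXn ltnn.
Qed.

Variable O : set K.
Hypotheses (avO : subring_avoiding t O) (valO : forall x, O x \/ O x^-1).
Hypothesis unitO : forall a, O a -> O (1 - t^-1 * a)^-1.

Let ringO : is_subring O. Proof. by case: avO. Qed.
Let Ot1 : O t^-1. Proof. by case: avO. Qed.

Lemma subring_const c : O (embA K c%:P).
Proof.
have [Oc|Oc] := valO (embA K c%:P) => //.
have [->|c0] := eqVneq c 0; first by rewrite polyC0 rmorph0; exact: (subring0 ringO).
have c0' : embA K c%:P != 0 by rewrite embA_eq0 polyC_eq0.
have cE := embA_const_root_of_unity K c0.
have -> : embA K c%:P = (embA K c%:P)^-1 ^+ #|F|.-2.
  by apply: (mulIf (expf_neq0 #|F|.-2 c0')); rewrite -exprS cE -exprMn mulVf// expr1n.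
exact: subringX.
Qed.

Lemma subring_embA (f : {poly F}) n : (size f <= n.+1)%N -> O (embA K f * t^-1 ^+ n).
Proof.
move=> sf; rewrite -[f]coefK poly_def rmorph_sum /= mulr_suml.
apply: (subring_sum ringO) => i _; rewrite -mul_polyC rmorphM rmorphXn /= -/t -mulrA.
apply: (subringM ringO); first exact: subring_const.
have -> : t ^+ i * t^-1 ^+ n = t^-1 ^+ (n - i).
  have t0 := embA_X_neq0; have ni : (i <= n)%N by rewrite -ltnS (leq_trans (ltn_ord i)).
  rewrite -{1}(subnK ni) exprD mulrCA [t^-1 ^+ i]exprVn divff ?mulr1//.
  by rewrite expf_neq0.
exact: subringX.
Qed.

(** For d > 0, f = l t^d (1 - t^-1 b) with l constant and b in [O]; all three factors have their
    inverses in [O]. *)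
Lemma subring_embAV (f : {poly F}) : f != 0 -> O (embA K f)^-1.
Proof.
move=> f0; pose d := (size f).-1; have fd : size f = d.+1 by rewrite prednK// size_poly_gt0.
pose l := f`_d; have l0 : l != 0 by rewrite /l -lead_coefE lead_coef_eq0.
pose g := f - l *: 'X^d.
have sg : (size g <= d)%N.
  apply/leq_sizeP => i di; rewrite coefB coefZ coefXn.
  have [->|id] := eqVneq i d; first by rewrite mulr1 subrr.
  by rewrite mulr0 subr0 nth_default// fd ltn_neqAle eq_sym id.
have t0 := embA_X_neq0.
have l0' : embA K l%:P != 0 by rewrite embA_eq0 polyC_eq0.
have lV : (embA K l%:P)^-1 = embA K (l^-1)%:P.
  by apply: (mulIf l0'); rewrite mulVf// -rmorphM -polyCM mulVf// polyC1 rmorph1.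
have fE : embA K f = embA K l%:P * t ^+ d + embA K g.
  by rewrite rmorphB -mul_polyC rmorphM rmorphXn /= addrC subrK.
have [d0|] := posnP d.
  have g0 : g = 0 by apply/eqP; rewrite -size_poly_eq0 -leqn0 -d0.
  by rewrite fE g0 rmorph0 addr0 d0 mulr1 lV; exact: subring_const.
case: d fd l l0 g sg l0' lV fE => // d fd l l0 g sg l0' lV fE _.
pose b := - (embA K (l^-1)%:P * (embA K g * t^-1 ^+ d)).
have Ob : O b.
  apply: (subringN ringO); apply: (subringM ringO); first exact: subring_const.
  exact: subring_embA.
have key : 1 - t^-1 * b = (embA K l%:P)^-1 * t^-1 ^+ d.+1 * embA K f.
  rewrite /b -lV fE mulrDr.
  have -> : (embA K l%:P)^-1 * t^-1 ^+ d.+1 * (embA K l%:P * t ^+ d.+1) = 1.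
    by rewrite mulrACA mulVf// mul1r exprVn mulVf// expf_neq0.
  by rewrite mulrN opprK exprS; ring.
have -> : (embA K f)^-1 = embA K (l^-1)%:P * (1 - t^-1 * b)^-1 * t^-1 ^+ d.+1.
  have f0' : embA K f != 0 by rewrite embA_eq0.
  rewrite key -lV; apply: divr_cancel_both => //; first by rewrite invr_eq0.
  by rewrite expf_neq0// invr_eq0.
apply: (subringM ringO); last exact: subringX.
by apply: (subringM ringO); [exact: subring_const | exact: unitO].
Qed.

(** x is algebraic over F[t]. If y = x t^(-a) is not in [O], then y^-1 is, and dividing the relation
    by y^(k-1) writes y through powers of y^-1, with coefficients in [O] once a is large. *)
Lemma subring_archimedean x : x != 0 -> exists a : nat, O (x * t^-1 ^+ a).
Proof.
move=> x0; have t0 := embA_X_neq0.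
have [|c [[i0 ci0] cE]] := @poly_dependent F K 'I_(\dim {:K}).+1 (fun i => x ^+ i).
  by rewrite card_ord.
pose k := [arg max_(i > i0 | (c i != 0)%R) (i : nat)]%N.
have [ck kmax] : c k != 0 /\ forall i, c i != 0 -> (i <= k)%N.
  by rewrite /k; case: arg_maxnP.
(* For i < k one has a (k - i) >= a >= size (c i), so t^(-a (k - i)) brings the coefficient c_i into
   [O]. *)
pose a := (\sum_i size (c i))%N; exists a; set y := x * _.
have [//|Oy] := valO y.
have y0 : y != 0 by rewrite mulf_neq0// expf_neq0// invr_eq0.
have xE : x = y * t ^+ a by rewrite /y -mulrA exprVn mulVf ?mulr1// expf_neq0.
have yE : y = - \sum_(i < (\dim {:K}).+1 | (i < k)%N)
    (embA K (c k))^-1 * (embA K (c i) * t^-1 ^+ (a * (k - i))) * y^-1 ^+ (k - i).-1.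
  have ck' : embA K (c k) != 0 by rewrite embA_eq0.
  have xk : x ^+ k = - \sum_(i < (\dim {:K}).+1 | (i < k)%N)
      (embA K (c k))^-1 * embA K (c i) * x ^+ i.
    apply: (mulfI ck'); rewrite mulrN mulr_sumr; apply/eqP; rewrite -addr_eq0 -[eqbRHS]cE.
    rewrite [eqbRHS](bigD1 k)//=; apply/eqP; congr (_ + _).
    rewrite big_mkcond [RHS]big_mkcond; apply: eq_bigr => i _.
    rewrite -!mulrA mulVKf// -val_eqE; case: (ltngtP i k) => //= ki.
    have [->|/kmax] := eqVneq (c i) 0; first by rewrite rmorph0 mul0r.
    by rewrite leqNgt ki.
  have k0 : (0 < k)%N.
    rewrite lt0n; apply/eqP => k0; move: xk; rewrite k0 expr0 big_pred0 ?oppr0 => [/eqP|//].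
    by rewrite oner_eq0.
  apply: (mulfI (expf_neq0 k.-1 y0)); rewrite -exprSr prednK// {1}/y exprMn xk mulNr mulrN.
  congr (- _); rewrite mulr_suml mulr_sumr; apply: eq_bigr => i ik.
  exact: (integral_relation_term _ _ (erefl y) y0 ik).
rewrite yE; apply: (subringN ringO); apply: (subring_sum ringO) => i ik.
apply: (subringM ringO); last exact: subringX.
apply: (subringM ringO); first exact: subring_embAV.
apply: subring_embA; rewrite leqW// (@leq_trans a)//.
  by rewrite /a (bigD1 i)//= leq_addr.
by rewrite leq_pmulr// subn_gt0.
Qed.

End PlaceAtInfinity.

(** [MK] is known only as a system of representatives, so an absolute value with |t| > 1 is built
    from a maximal subring; the equivalent element of [MK] still has |t| > 1. *)
Lemma exists_place_at_infinity (R : realType) (F : finFieldType)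
    (K : fieldExtType {fraction {poly F}}) (MK : set (K -> R)) :
  is_normalized_places MK -> exists2 v, MK v & 1 < v (embA K 'X).
Proof.
move=> hMK; have t0 := embA_X_neq0 K.
have [B avB] := subring_avoiding_embAX K.
have [V avO maxO] := exists_maximal_subring avB.
have valO := maximal_subring_valuation t0 avO maxO.
have archO := subring_archimedean avO valO (maximal_subring_unit t0 avO maxO).
pose f := @gauge_absval R K (embA K 'X) V.
have f1 : 1 < f (embA K 'X) by exact: gauge_absval_gt1.
case: (hMK) => _ /(_ f) + _ _; case.
- exact: is_absval_gauge.
- by exists (embA K 'X); rewrite t0 gt_eqF.
- move=> v [[Mv [s [s0 vf]]] _]; exists v => //.
  rewrite ltNge; apply/negP => v1; move: f1; rewrite vf ltNge => /negP; apply.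
  have vge0 : 0 <= v (embA K 'X) by exact: absval_ge0 (place_absval hMK Mv) _.
  have -> : 1 = 1 `^ s :> R by rewrite powR1.
  by apply: ge0_ler_powR; rewrite ?nnegrE ?ler01 ?(ltW s0).
Qed.

(** * Drinfeld modules *)

Section SkewSize.
Variables (K : fieldType) (s : {rmorphism K -> K}).

Lemma iter_rmorph_eq0 i x : (iter i s x == 0) = (x == 0).
Proof. by elim: i => //= i IHi; rewrite fmorph_eq0. Qed.

Lemma size_skew_mul (f g : {poly K}) : f != 0 -> g != 0 ->
  size (skew_mul s f g) = (size f + size g).-1.
Proof.
move=> f0 g0; have [df dg] : size f = (size f).-1.+1 /\ size g = (size g).-1.+1.
  by rewrite !prednK ?size_poly_gt0.
rewrite df dg addSn addnS /=; move: (size f).-1 (size g).-1 df dg => d e df dg.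
apply/eqP; rewrite eqn_leq; apply/andP; split.
  rewrite /skew_mul df; apply: (leq_trans (size_sum _ _ _)); apply/bigmax_leqP => i _.
  rewrite (leq_trans (size_scale_leq _ _))// (leq_trans (size_polyMleq _ _))//.
  rewrite size_polyXn addnS /= addnC -addnS leq_add//; first by rewrite -ltnS.
  by rewrite -dg size_poly.
rewrite ltnNge; apply/negP => /leq_sizeP/(_ _ (leqnn _)).
rewrite /skew_mul df coef_sum big_ord_recr /= big1 => [|i _].
  rewrite add0r coefZ coefMXn ltnNge leq_addr /= addKn coef_map_id0 ?iter_s0//.
  move/eqP; rewrite mulf_eq0 iter_rmorph_eq0.
  rewrite -[d]/(d.+1.-1) -[e in g`_e]/(e.+1.-1) -df -dg -!lead_coefE !lead_coef_eq0.
  by rewrite (negPf f0) (negPf g0).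
rewrite coefZ coefMXn; case: ltnP => _; first by rewrite mulr0.
rewrite coef_map_id0 ?iter_s0// (@nth_default _ 0 g) ?iter_s0 ?mulr0//.
by rewrite dg; have := ltn_ord i; lia.
Qed.

Lemma skew_mulC (a b : K) : skew_mul s a%:P b%:P = (a * b)%:P.
Proof. by have := skew_mul_monom s a b 0 0; rewrite !alg_polyC. Qed.

Lemma skew_evalC (a x : K) : skew_eval (a%:P : skew_poly s) x = a * x.
Proof. by have := skew_eval_monom s a 0 x; rewrite alg_polyC. Qed.

(* Taking the n-th power multiplies the degree in tau by n. *)
Lemma skew_expr_fixed_const (f : skew_poly s) n : (f : {poly K}) != 0 -> (1 < n)%N ->
  f ^+ n = f -> f = ((f : {poly K})`_0)%:P :> {poly K}.
Proof.
move=> f0 n1 fn; apply: size1_polyC.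
have s0 : (0 < size (f : {poly K}))%N by rewrite size_poly_gt0.
have sX k : ((f ^+ k : {poly K}) != 0) /\ size (f ^+ k : {poly K}) = ((size (f : {poly K})).-1 * k).+1.
  elim: k => [|k [fk0 sk]].
    by rewrite expr0 muln0; split; [exact: oner_neq0 | exact: size_poly1].
  have sz : size (f ^+ k.+1 : {poly K}) = ((size (f : {poly K})).-1 * k.+1).+1.
    rewrite exprS [LHS]size_skew_mul// sk mulnS addnS /=.
    by rewrite -[in LHS](prednK s0) addSn.
  by split=> //; rewrite -size_poly_gt0 sz.
have [_] := sX n; rewrite fn; move: s0; case: (size _) => [//|d] _ [] /=.
by case: d => // d; nia.
Qed.

End SkewSize.

Section DrinfeldModule.
Variables (F : finFieldType) (K : fieldExtType {fraction {poly F}}).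
Variable phi : {rmorphism {poly F} -> Ktau K}.
Hypothesis hphi : is_drinfeld_module phi.

Lemma iter_frob i (x : K) : iter i (@frob F K) x = x ^+ (#|F| ^ i).
Proof. by elim: i => [|i /= ->]; rewrite ?expr1// /frob -exprM expnSr. Qed.

Lemma drinfeld_coef0 a : (phi a : {poly K})`_0 = embA K a.
Proof. by case: hphi. Qed.

(** c^q = c gives phi_c^q = phi_c, which is impossible in positive degree in tau. *)
Lemma drinfeld_const c : phi c%:P = (embA K c%:P)%:P :> {poly K}.
Proof.
have [->|c0] := eqVneq c 0; first by rewrite polyC0 !rmorph0.
rewrite -drinfeld_coef0; apply: (@skew_expr_fixed_const _ _ _ #|F|).
- apply/eqP => phi0; have := drinfeld_coef0 c%:P; rewrite phi0 coef0 => /eqP.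
  by rewrite eq_sym embA_eq0 polyC_eq0 (negPf c0).
- exact: finNzRing_gt1.
- by rewrite -rmorphXn -polyC_exp expf_card.
Qed.

(** If phi_t had degree 0 in tau, so would every phi_a, since t and the constants generate F[t]. *)
Lemma drinfeld_size_gt1 : (1 < size (phi 'X : {poly K}))%N.
Proof.
rewrite ltnNge; apply/negP => s1; case: hphi => _ [a]; apply.
elim/poly_ind: a => [|a c IH]; first by rewrite !rmorph0.
have /size1_polyC EX := s1.
rewrite !rmorphD !rmorphM /= -drinfeld_const; congr (_ + _).
rewrite -[LHS]/(skew_mul (@frob F K) (phi a) (phi 'X)) IH EX drinfeld_coef0.
by rewrite skew_mulC -polyCM.
Qed.

Variables (p m : nat).
Hypothesis cardF : #|F| = (p * m)%N.

Let m0 : (0 < m)%N.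
Proof. by have := finNzRing_gt1 F; rewrite cardF; case: m => //; rewrite muln0. Qed.

(** The part of phi_t of positive degree in tau, as a polynomial in y^p: q^(i+1) = p (m q^i). *)
Definition drinfeld_tail : {poly K} :=
  \sum_(i < (size (phi 'X : {poly K})).-1) (phi 'X : {poly K})`_i.+1 *: 'X^(m * #|F| ^ i).

Lemma drinfeld_evalX y :
  skew_eval (phi 'X) y = embA K 'X * y + drinfeld_tail.[y ^+ p].
Proof.
have sE : size (phi 'X : {poly K}) = (size (phi 'X : {poly K})).-1.+1.
  by rewrite prednK// (ltn_trans _ drinfeld_size_gt1).
rewrite (@skew_eval_wide _ _ _ (phi 'X) y (eq_leq sE)) big_ord_recl /= drinfeld_coef0; congr (_ + _).
rewrite /drinfeld_tail horner_sum; apply: eq_bigr => i _.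
rewrite hornerZ hornerXn -exprM mulnA -cardF -expnS.
by rewrite -iter_frob.
Qed.

Lemma drinfeld_tail_size : (1 < size drinfeld_tail)%N.
Proof.
have s1 := drinfeld_size_gt1.
pose n := (size (phi 'X : {poly K})).-2.
have sE : size (phi 'X : {poly K}) = n.+2 by rewrite /n; lia.
have cn : drinfeld_tail`_(m * #|F| ^ n) != 0.
  rewrite /drinfeld_tail sE /= coef_sum (bigD1 ord_max)//= big1 ?addr0 => [|i ni].
    rewrite coefZ coefXn eqxx mulr1 -[n.+1]/(n.+2.-1) -sE -lead_coefE lead_coef_eq0.
    by rewrite -size_poly_gt0 sE.
  rewrite coefZ coefXn eqn_pmul2l// eqn_exp2l ?finNzRing_gt1//.
  by move: ni; rewrite -val_eqE eq_sym /= => /negPf ->; rewrite mulr0.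
rewrite ltnNge; apply: contra cn => sT; rewrite nth_default// (leq_trans sT)//.
by rewrite muln_gt0 m0 expn_gt0 (ltn_trans _ (finNzRing_gt1 F)).
Qed.

(** Injectivity is where [beta] being nontorsion enters. *)
Lemma drinfeld_orbit beta : ~ torsion phi beta ->
  additive_orbit p m (embA K 'X) drinfeld_tail (fun c => embA K c%:P)
    (fun Q => skew_eval (phi Q) beta).
Proof.
move=> nt; split.
- by move=> P Q; rewrite rmorphD skew_evalD.
- move=> P Q /= PQ; apply/eqP; rewrite -subr_eq0; apply/negPn/negP => PQ0.
  apply: nt; exists (P - Q); split=> //; apply: (@addIr _ (skew_eval (phi Q) beta)).
  by rewrite -skew_evalD -rmorphD subrK PQ add0r.
- by move=> Q; rewrite mulrC rmorphM skew_evalM drinfeld_evalX.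
- by move=> c Q; rewrite rmorphM skew_evalM drinfeld_const skew_evalC.
- by move=> c; rewrite -cardF -rmorphXn -polyC_exp expf_card.
Qed.

End DrinfeldModule.

Theorem theorem2p5 (R : realType) (F : finFieldType)
    (K : fieldExtType {fraction {poly F}})
    (MK : set (K -> R)) (hMK : is_normalized_places MK)
    (phi : {rmorphism {poly F} -> Ktau K}) (hphi : is_drinfeld_module phi)
    (H1 : forall v : K -> R, MK v -> ~ infinite_place v ->
      forall gamma alpha : K, exists C1 C2 C3 : R,
        [/\ 0 < C1, 0 < C2, 0 < C3 &
            forall P : {poly F},
              skew_eval (phi P) gamma = alpha \/
              - C1 - C2 * (polydeg P)%:R `^ C3
                <= ln (v (skew_eval (phi P) gamma - alpha))])
    (beta : K) (hbeta : ~ torsion phi beta) (alpha : K)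
    (S : set (K -> R)) (hS : S `<=` MK) (finS : finite_set S) :
  finite_set [set Q : {poly F} |
    S_integral MK S alpha (skew_eval (phi Q) beta)].
Proof.
have [p p_prime charF] := finPcharP F.
have charK := pchar_funext K charF.
have [m cardF] := card_finField_pfactor charF.
have m_gt0 : (0 < m)%N.
  by have := finNzRing_gt1 F; rewrite cardF; case: m {cardF} => //; rewrite muln0.
have [v Mv vX] := exists_place_at_infinity hMK.
(* [T] contains the places with |alpha| > 1; away from it only the first clause of [S_integral] is
   in force. *)
have [T [TMK finT T1]] := finite_bad_places hMK [:: alpha].
have orb := drinfeld_orbit hphi cardF hbeta.
have sTail := drinfeld_tail_size hphi cardF.
have lnN : ln (v (embA K 'X)) < (Num.bound (ln (v (embA K 'X))))%:R.
  by apply: archi_boundP; rewrite ln_ge0// ltW.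
have finST : finite_set (S `|` T) by rewrite finite_setU.
have STMK : S `|` T `<=` MK by move=> w [/hS|/TMK].
apply: sub_finite_set (orbit_integral_finite hMK charK
  (fun y => pth_power_dependent y charF) (@northcott _ _ _ _ hMK _ Mv vX)
  Mv m_gt0 alpha orb sTail vX lnN finST STMK).
move=> Q intQ w Mw /not_orP[nSw nTw].
rewrite -(absvalN (place_absval hMK Mw)) opprB; apply: (intQ w Mw nSw).1.
by apply: T1 => //; rewrite inE.
Qed.
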